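(* Let $\lambda,\mu\in\Lambda$ and $g\in\mathscr D_{\lambda\mu}$. Then $\overline{T^g_{\lambda\mu}}\in\mathbb H_{\lambda\mu}$. Precisely, $$\overline{T^g_{\lambda\mu}}\in q_0^{\ell_{\mathfrak c_0}(g^+_{\lambda\mu})-\ell_{\mathfrak c_d}(g^+_{\lambda\mu})}\,q_1^{\ell_{\mathfrak c_0}(g^+_{\lambda\mu})+\ell_{\mathfrak c_d}(g^+_{\lambda\mu})}\,q^{2\ell_{\mathfrak a}(g^+_{\lambda\mu})}\,T^g_{\lambda\mu}+\sum_{y\in\mathscr D_{\lambda\mu},\,y<g}\mathbb Z[q^{\pm1},q_0^{\pm1},q_1^{\pm1}]\,T^y_{\lambda\mu}.$$ Moreover, $q_0^{\frac12(\ell_{\mathfrak c_0}(w^\mu_\circ)-\ell_{\mathfrak c_d}(w^\mu_\circ))}\,q_1^{\frac12(\ell_{\mathfrak c_0}(w^\mu_\circ)+\ell_{\mathfrak c_d}(w^\mu_\circ))}\,q^{\ell_{\mathfrak a}(w^\mu_\circ)}\,x_\mu$ is bar-invariant.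
   Context: Fix integers $r\ge 0$, $d\ge 2$; $D=2d+2$, $\mathbb N=\{0,1,\dots\}$. $W$ is the group of permutations $g$ of $\mathbb Z$ with $g(i+D)=g(i)+D$ and $g(-i)=-g(i)$ (affine Weyl group of type $\widetilde C_d$). Let $(i,j)_{\mathfrak c}$ swap $kD+i\leftrightarrow kD+j$ and $kD-i\leftrightarrow kD-j$ for all $k$ and fix other integers. $W$ is a Coxeter group with generators $s_0=(1,-1)_{\mathfrak c}$, $s_i=(i,i+1)_{\mathfrak c}$ ($1\le i\le d-1$), $s_d=(d,d+2)_{\mathfrak c}$; $\ell$ is the length, $\ell_{\mathfrak c_0}(g)$ (resp. $\ell_{\mathfrak c_d}(g)$) the number of $s_0$ (resp. $s_d$) in a reduced expression of $g$, $\ell_{\mathfrak a}=\ell-\ell_{\mathfrak c_0}-\ell_{\mathfrak c_d}$, and $\le$ is the Bruhat order. $\Lambda$ is the set of $\lambda=(\lambda_0,\dots,\lambda_{r+1})\in\mathbb N^{r+2}$ with sum $d$; $\lambda_{0,i}=\lambda_0+\cdots+\lambda_i$; $W_\lambda$ is the (finite) parabolic subgroup generated by $\{s_0,\dots,s_d\}\setminus\{s_{\lambda_0},s_{\lambda_{0,1}},\dots,s_{\lambda_{0,r}}\}$; $\mathscr D_\lambda=\{g:\ell(wg)=\ell(w)+\ell(g)\ \forall w\in W_\lambda\}$, $\mathscr D_{\lambda\mu}=\mathscr D_\lambda\cap\mathscr D_\mu^{-1}$. $g^+_{\lambda\mu}$ is the longest element of $W_\lambda gW_\mu$, and $w^\mu_\circ$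 the longest element of $W_\mu$. $\mathbb A=\mathbb Z[q^{\pm1/2},q_0^{\pm1/2},q_1^{\pm1/2}]$. $\mathbb H$ is the $\mathbb A$-algebra generated by $T_0,\dots,T_d$ with the braid relations of $W$ and $(T_0-q_0^{-1})(T_0+q_1)=0$, $(T_i-q^{-1})(T_i+q)=0$ ($1\le i\le d-1$), $(T_d-q_1^{-1})(T_d+q_0^{-1})=0$. For a reduced word $w=s_{i_1}\cdots s_{i_l}$, $T_w=T_{i_1}\cdots T_{i_l}$, $q_w=\prod_kq_{s_{i_k}}$, with $q_{s_0}=q_1$, $q_{s_i}=q$ ($1\le i\le d-1$), $q_{s_d}=q_0^{-1}$. $T_X=\sum_{w\in X}q_w^{-1}T_w$ for finite $X\subset W$; $x_\mu=T_{W_\mu}$; $T^g_{\lambda\mu}=T_{W_\lambda gW_\mu}$. $\mathbb H_{\lambda\mu}$ is the $\mathbb Z[q^{\pm1},q_0^{\pm1},q_1^{\pm1}]$-submodule of $\mathbb H$ with basis $\{T^g_{\lambda\mu}\}_{g\in\mathscr D_{\lambda\mu}}$. The bar involution of $\mathbb H$ is the ring involution inverting $q^{1/2},q_0^{1/2},q_1^{1/2}$ and sending $T_w\mapsto T_{w^{-1}}^{-1}$. *)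

(* Defs.v *)
From HB Require Import structures.
From mathcomp Require Import all_boot all_order all_algebra.
From mathcomp Require Import finmap.
From mathcomp Require Import zify ring.
From mathcomp Require Import mathcomp_extra boolp classical_sets cardinality fsbigop.
From mathcomp.multinomials Require Import monalg.

Set Implicit Arguments.
Unset Strict Implicit.
Unset Printing Implicit Defensive.

Import GRing.Theory.
Local Open Scope fset_scope.
Local Open Scope ring_scope.

(* The group ring of Z^3: (a, b, c) is the exponent of
   q^(a/2) q_0^(b/2) q_1^(c/2).  The ring structure of {malg _[_]} cannot be
   reused, because [monomType] excludes monoids with non-trivial units. *)
Definition expo : Type := (int * int * int)%type.
HB.instance Definition _ := GRing.Zmodule.on expo.
Definition laurent : Type := {malg int[expo]}.
HB.instance Definition _ := GRing.Zmodule.on laurent.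

HB.lock Definition lmul (a b : laurent) : laurent :=
  \sum_(k <- msupp a) \sum_(l <- msupp b) << a@_k * b@_l *g k + l >>.

HB.lock Definition lbar (a : laurent) : laurent :=
  \sum_(k <- msupp a) << a@_k *g - k >>.

Section LaurentRing.
Implicit Types (a b c : laurent) (k l : expo).

Definition lmon k : laurent := << k >>.

Lemma lmulw (d1 d2 : {fset expo}) a b : msupp a `<=` d1 -> msupp b `<=` d2 ->
  lmul a b = \sum_(k <- d1) \sum_(l <- d2) << a@_k * b@_l *g k + l >>.
Proof.
move=> s1 s2; rewrite lmul.unlock (big_fset_incl _ s1) /=.
  apply/eq_bigr=> k _; apply/big_fset_incl => // l _ /mcoeff_outdom ->.
  by rewrite mulr0 monalgU0.
move=> k _ /mcoeff_outdom ak.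
by rewrite big1 => // l _; rewrite ak mul0r monalgU0.
Qed.

Lemma lmulC : commutative lmul.
Proof.
move=> a b; rewrite lmul.unlock exchange_big; apply/eq_bigr => l _; apply/eq_bigr => k _.
by rewrite mulrC addrC.
Qed.

Lemma lmul0 a : lmul 0 a = 0.
Proof. by rewrite lmul.unlock msupp0 big_seq_fset0. Qed.

Lemma lmulDl : left_distributive lmul +%R.
Proof.
move=> a b c.
rewrite (lmulw (msuppD_le a b) (fsubset_refl _)).
rewrite (lmulw (fsubsetUl (msupp a) (msupp b)) (fsubset_refl (msupp c))).
rewrite (lmulw (fsubsetUr (msupp a) (msupp b)) (fsubset_refl (msupp c))).
rewrite -big_split /=; apply/eq_bigr=> k _.
rewrite -big_split /=; apply/eq_bigr=> l _.
by rewrite mcoeffD mulrDl monalgUD.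
Qed.

Lemma lmulDr : right_distributive lmul +%R.
Proof. by move=> c a b; rewrite !(lmulC c) lmulDl. Qed.

Lemma lmulU x y k l : lmul << x *g k >> << y *g l >> = << x * y *g k + l >>.
Proof. by rewrite (lmulw msuppU_le msuppU_le) !big_seq_fset1 !mcoeffUU. Qed.

Lemma lmul_suml (I : Type) (r : seq I) (F : I -> laurent) a :
  lmul (\sum_(i <- r) F i) a = \sum_(i <- r) lmul (F i) a.
Proof. exact: (big_morph (lmul^~ a) (fun _ _ => lmulDl _ _ _) (lmul0 a)). Qed.

Lemma lmul_sumr (I : Type) (r : seq I) (F : I -> laurent) a :
  lmul a (\sum_(i <- r) F i) = \sum_(i <- r) lmul a (F i).
Proof. by rewrite lmulC lmul_suml; apply: eq_bigr => i _; rewrite lmulC. Qed.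

Lemma lmulA : associative lmul.
Proof.
move=> a b c; rewrite (monalgE a) !lmul_suml; apply: eq_bigr => k _.
rewrite (monalgE b) lmul_sumr !lmul_suml lmul_sumr; apply: eq_bigr => l _.
rewrite (monalgE c) !lmul_sumr; apply: eq_bigr => m _.
rewrite (lmulU b@_l) (lmulU a@_k b@_l).
rewrite (lmulU a@_k) (lmulU (a@_k * b@_l)).
by congr (<< _ *g _ >>); [exact: addrA | exact: mulrA].
Qed.

Lemma lmul1 : left_id (lmon 0) lmul.
Proof.
move=> a; rewrite {1}(monalgE a) lmul_sumr [RHS]monalgE.
by apply: eq_bigr => k _; rewrite lmulU mul1r add0r.
Qed.

Lemma lmon0_neq0 : lmon 0 != 0.
Proof. by rewrite monalgU_eq0. Qed.

HB.instance Definition _ := GRing.Zmodule_isComNzRing.Build laurent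
  lmulA lmulC lmul1 lmulDl lmon0_neq0.

Lemma lmonD k l : lmon (k + l) = lmon k * lmon l.
Proof. by rewrite [RHS]lmulU mulr1. Qed.

Lemma lmon0 : lmon 0 = 1.
Proof. by []. Qed.

Definition lunit : {pred laurent} := fun a => `[< exists b, b * a = 1 >].
Definition linv a : laurent := xget a [set b | b * a = 1].

Lemma lmulVr : {in lunit, left_inverse 1 linv *%R}.
Proof. by move=> a /asboolP; rewrite /linv => /(@xgetPex _ a [set b | b * a = 1]). Qed.

Lemma lunitP a b : b * a = 1 -> a \in lunit.
Proof. by move=> ba1; apply/asboolP; exists b. Qed.

Lemma linv_out : {in [predC lunit], linv =1 id}.
Proof.
move=> a nua; rewrite /linv; case: xgetP => // b _ /= /lunitP ua.
by rewrite inE ua in nua.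
Qed.

HB.instance Definition _ := GRing.ComNzRing_hasMulInverse.Build laurent
  lmulVr lunitP linv_out.

Lemma lmon_unit k : lmon k \is a GRing.unit.
Proof. by apply/unitrP; exists (lmon (- k)); rewrite -!lmonD subrr addNr. Qed.

Lemma lmonV k : (lmon k)^-1 = lmon (- k).
Proof. by apply: (mulrI (lmon_unit k)); rewrite divrr ?lmon_unit// -lmonD subrr. Qed.

Lemma lbarE a k : (lbar a)@_k = a@_(- k).
Proof.
rewrite {2}[a]monalgE lbar.unlock !raddf_sum; apply/eq_bigr=> /= l _.
by rewrite !mcoeffU eqr_oppLR.
Qed.

Lemma lbar_is_zmod_morphism : zmod_morphism lbar.
Proof. by move=> a b; apply/malgP => k; rewrite mcoeffB !lbarE mcoeffB. Qed.

HB.instance Definition _ :=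
  GRing.isZmodMorphism.Build laurent laurent lbar lbar_is_zmod_morphism.

Lemma lbarU x k : lbar << x *g k >> = << x *g - k >>.
Proof. by apply/malgP => l; rewrite lbarE !mcoeffU eqr_oppLR. Qed.

Lemma lbar_is_monoid_morphism : monoid_morphism lbar.
Proof.
split; first by rewrite [LHS]lbarU oppr0.
move=> a b; change (lbar (lmul a b) = lmul (lbar a) (lbar b)).
have bE c : lbar c = \sum_(k <- msupp c) << c@_k *g - k >> by rewrite lbar.unlock.
rewrite (bE a) (bE b) {1}(monalgE a) {1}(monalgE b) !lmul_suml raddf_sum.
apply: eq_bigr => k _; rewrite lmul_sumr [RHS]lmul_sumr (raddf_sum lbar); apply: eq_bigr => l _.
by rewrite !lmulU /= lbarU opprD.
Qed.

HB.instance Definition _ :=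
  GRing.isMonoidMorphism.Build laurent laurent lbar lbar_is_monoid_morphism.

Lemma lbarK : involutive lbar.
Proof. by move=> a; apply/malgP => k; rewrite !lbarE opprK. Qed.

Lemma lbar_mon k : lbar (lmon k) = (lmon k)^-1.
Proof. by rewrite lmonV [LHS]lbarU. Qed.

End LaurentRing.
Local Close Scope fset_scope.
Local Open Scope classical_set_scope.

Section AffineWeylGroup.
Variable d : nat.

Definition period : int := (2 * d + 2)%:Z.

Definition affine_perm (f : int -> int) : Prop :=
  [/\ bijective f, forall i, f (i + period) = f i + period
    & forall i, f (- i) = - f i].

Record affC := AffC { affC_fun :> int -> int; _ : `[< affine_perm affC_fun >] }.
HB.instance Definition _ := [isSub for affC_fun].
HB.instance Definition _ := [Choice of affC by <:].

Implicit Types g h : affC.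

Lemma affCP g : affine_perm g.
Proof. by case: g => f /= /asboolP. Qed.

Lemma affC_ext g h : g =1 h -> g = h.
Proof. by move=> gh; apply/val_inj/funext. Qed.

Lemma affine_perm_id : affine_perm id.
Proof. by split=> //; exists id. Qed.

Lemma affine_perm_comp f1 f2 :
  affine_perm f1 -> affine_perm f2 -> affine_perm (f1 \o f2).
Proof.
move=> [b1 p1 n1] [b2 p2 n2]; split=> [|i|i] /=; first exact: bij_comp.
  by rewrite p2 p1.
by rewrite n2 n1.
Qed.

Lemma affine_perm_inv f f' : affine_perm f -> cancel f f' -> cancel f' f ->
  affine_perm f'.
Proof.
move=> [bf p n] fK f'K; split=> [|i|i]; first by exists f.
  by apply: (can_inj fK); rewrite p !f'K.
by apply: (can_inj fK); rewrite n !f'K.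
Qed.

Lemma affC_inv_exists g : exists h : affC, cancel g h /\ cancel h g.
Proof.
have [[f' gK f'K] _ _] := affCP g.
by exists (AffC (introT (asboolP _) (affine_perm_inv (affCP g) gK f'K))).
Qed.

Definition affC_one : affC := AffC (introT (asboolP _) affine_perm_id).
Definition affC_mul g h : affC :=
  AffC (introT (asboolP _) (affine_perm_comp (affCP g) (affCP h))).
Definition affC_inv g : affC := sval (cid (affC_inv_exists g)).

Lemma affC_invP g : cancel g (affC_inv g) /\ cancel (affC_inv g) g.
Proof. exact: svalP (cid (affC_inv_exists g)). Qed.

Lemma affC_mulA : associative affC_mul.
Proof. by move=> g h k; apply: affC_ext. Qed.

Lemma affC_mul1 : left_id affC_one affC_mul.
Proof. by move=> g; apply: affC_ext. Qed.

Lemma affC_mulr1 : right_id affC_one affC_mul.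
Proof. by move=> g; apply: affC_ext. Qed.

Lemma affC_mulV : left_inverse affC_one affC_inv affC_mul.
Proof. by move=> g; apply: affC_ext => i /=; rewrite (affC_invP g).1. Qed.

Lemma affC_mulrV : right_inverse affC_one affC_inv affC_mul.
Proof. by move=> g; apply: affC_ext => i /=; rewrite (affC_invP g).2. Qed.

HB.instance Definition _ := isGroup.Build affC
  affC_mulA affC_mul1 affC_mulr1 affC_mulV affC_mulrV.

(* (i, j)_c *)
Definition cswap_fun (i j x : int) : int :=
  if (x == i %[mod period])%Z then x - i + j
  else if (x == j %[mod period])%Z then x - j + i
  else if (x == - i %[mod period])%Z then x + i - j
  else if (x == - j %[mod period])%Z then x + j - i
  else x.

(* The default value 1 of [insubd] is not reached for the pairs [sgen_pair i]
   when d >= 1 (lemma [sgenE]). *)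
Definition cswap (i j : int) : affC := insubd (1%g : affC) (cswap_fun i j).

Definition sgen_pair (i : 'I_d.+1) : int * int :=
  if i == 0 :> nat then (1, - 1)
  else if i == d :> nat then (d%:Z, d%:Z + 2)
  else (i%:Z, i%:Z + 1).

Definition sgen (i : 'I_d.+1) : affC := cswap (sgen_pair i).1 (sgen_pair i).2.

Section Cswap.
Variables i j : int.
Hypotheses (ij : (i != j %[mod period])%Z) (i2 : (i != - i %[mod period])%Z)
  (j2 : (j != - j %[mod period])%Z).

Let dv (n : int) := (period %| n)%Z.
Let up x := dv (x - i) || dv (x + j).
Let dn x := dv (x - j) || dv (x + i).

Let dvE n m : n = m -> dv m -> dv n. Proof. by move->. Qed.
Let dvN n : dv n -> dv (- n). Proof. by rewrite /dv rpredN. Qed.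
Let dvB n m : dv n -> dv m -> dv (n - m). Proof. exact: rpredB. Qed.
Let dv_period n : dv (n + period) = dv n.
Proof. by rewrite /dv rpredDr // dvdzz. Qed.

Let upN x : up (- x) = dn x.
Proof.
have e n m : n = - m -> dv n = dv m by move=> ->; rewrite /dv rpredN.
by rewrite /up /dn orbC (e _ (x - j)) ?(e (- x - i) (x + i)); lia.
Qed.

Let up_up x : up x -> dn (x + (j - i)).
Proof.
by case/orP=> h; apply/orP; [left|right]; apply: dvE h; lia.
Qed.

Let up_dn x : up x -> dn x = false.
Proof.
move: ij i2 j2; rewrite !eqz_mod_dvd => /negP h1 /negP h2 /negP h3.
case/orP=> hx; apply/negP => /orP[] hy; have hz := dvB hx hy.
- by apply: h1; apply: dvE (dvN hz); lia.
- by apply: h2; apply: dvE (dvN hz); lia.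
- by apply: h3; apply: dvE hz; lia.
- by apply: h1; apply: dvE (dvN hz); lia.
Qed.

Let up_period x : up (x + period) = up x.
Proof.
by rewrite /up (addrAC x period (- i)) (addrAC x period j) !dv_period.
Qed.

Let cswap_funE x :
  cswap_fun i j x = if up x then x + (j - i) else if dn x then x - (j - i) else x.
Proof.
rewrite /cswap_fun !eqz_mod_dvd !opprK; have := @up_dn x; rewrite /up /dn.
rewrite -/(dv (x - i)) -/(dv (x - j)) -/(dv (x + i)) -/(dv (x + j)).
case: (dv (x - i)); case: (dv (x - j)); case: (dv (x + i));
  case: (dv (x + j)) => //= h; try lia; by have := h isT.
Qed.

Let up_gt0 x : up x -> up (x + (j - i)) = false.
Proof. by move=> /up_up h; apply/negP => /up_dn; rewrite h. Qed.

Lemma affine_perm_cswap : affine_perm (cswap_fun i j).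
Proof.
have dnN x : dn (- x) = up x by rewrite -upN opprK.
have dn_up x : dn x -> up (x - (j - i)).
  by rewrite -upN => /up_up; rewrite -upN; congr (up _); lia.
have dn_period x : dn (x + period) = dn x.
  by rewrite -!upN -[LHS]up_period; congr (up _); lia.
split=> [|x|x]; last 2 first.
- by rewrite !cswap_funE up_period dn_period; case: (up x); case: (dn x); lia.
- rewrite !cswap_funE upN dnN; have := @up_dn x.
  by case: (up x) => [->//|_]; case: (dn x); lia.
have fK : involutive (cswap_fun i j).
  move=> x; rewrite [cswap_fun i j x]cswap_funE; case: ifP => [ux|nux].
    by rewrite cswap_funE up_gt0// up_up//; lia.
  case: ifP => [dx|ndx]; rewrite cswap_funE ?nux ?ndx//.
  by rewrite dn_up//; lia.
by exists (cswap_fun i j).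
Qed.

End Cswap.

Lemma sgenE (i : 'I_d.+1) : (0 < d)%N ->
  sgen i =1 cswap_fun (sgen_pair i).1 (sgen_pair i).2.
Proof.
move=> d_gt0 x; rewrite /sgen /cswap /= insubdK//; apply/asboolP.
have small n : (0 < `|n|)%N -> (`|n| < 2 * d + 2)%N -> (period %| n)%Z = false.
  by move=> n0 nd; rewrite dvdzE; apply: gtnNdvd.
have ltid := ltn_ord i.
have sd : (period %| d%:Z + 2 - - (d%:Z + 2))%Z = false.
  have -> : d%:Z + 2 - - (d%:Z + 2) = 2 + period by rewrite /period; lia.
  by rewrite rpredDr ?dvdzz// small//; lia.
by apply: affine_perm_cswap; rewrite /sgen_pair !eqz_mod_dvd;
  do 2?case: eqP => /= ?; rewrite ?sd ?small//; lia.
Qed.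

End AffineWeylGroup.

Section CoxeterNotions.
Variable d : nat.
Local Notation W := (affC d).
Local Notation word := (seq 'I_d.+1).
Implicit Types (u v : word) (g h w x y t : W) (X : set W).

Definition word_val u : W := (\prod_(i <- u) sgen i)%g.

Definition reduced u : Prop :=
  forall v, word_val v = word_val u -> (size u <= size v)%N.

(* A chosen reduced expression.  The quantities [len_c0], [len_cd], [qW] and
   [hTW] computed from it do not depend on the choice (Matsumoto's theorem). *)
Definition rexpr w : word := xget [::] [set u | word_val u = w /\ reduced u].

Definition len w : nat := size (rexpr w).
Definition len_c0 w : nat := count_mem ord0 (rexpr w).
Definition len_cd w : nat := count_mem ord_max (rexpr w).
(* [ord0] and [ord_max] are distinct for d >= 1, so the subtractions are exact. *)
Definition len_a w : nat := len w - len_c0 w - len_cd w.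

Definition reflection t : Prop := exists w i, t = (w * sgen i * w^-1)%g.

(* Bruhat order: x <= x t whenever t is a reflection that increases the length *)
Inductive bruhat_le : W -> W -> Prop :=
| bruhat_refl w : bruhat_le w w
| bruhat_step x t w : reflection t -> (len x < len (x * t)%g)%N ->
    bruhat_le (x * t)%g w -> bruhat_le x w.

Definition bruhat_lt x y : Prop := bruhat_le x y /\ x <> y.

Definition is_longest X x : Prop := X x /\ forall y, X y -> (len y <= len x)%N.
Definition longest X : W := xget 1%g [set x | is_longest X x].

Definition gen_subgroup X : set W :=
  smallest [set G : set W | group_closed (mem G)] X.

Section Parabolic.
Variable r : nat.
Implicit Types lam mu : {ffun 'I_r.+2 -> nat}.

Definition Lambda : set {ffun 'I_r.+2 -> nat} :=
  [set lam | (\sum_i lam i = d)%N].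

(* lambda_{0,i} *)
Definition psum lam (i : 'I_r.+1) : nat := (\sum_(j < r.+2 | j <= i) lam j)%N.

Definition parabolic lam : set W :=
  gen_subgroup [set sgen k | k in [set k : 'I_d.+1 | forall i, k <> psum lam i :> nat]].

Definition Dleft lam : set W :=
  [set g | forall w, parabolic lam w -> len (w * g)%g = (len w + len g)%N].

Definition Ddouble lam mu : set W :=
  [set g | Dleft lam g /\ Dleft mu (g^-1)%g].

Definition dcoset lam g mu : set W :=
  [set (a * g * b)%g | a in parabolic lam & b in parabolic mu].

End Parabolic.
End CoxeterNotions.

(* q^{1/2}, q_0^{1/2}, q_1^{1/2} *)
Definition qh : laurent := lmon (1, 0, 0).
Definition q0h : laurent := lmon (0, 1, 0).
Definition q1h : laurent := lmon (0, 0, 1).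
Definition q : laurent := qh ^+ 2.
Definition q0 : laurent := q0h ^+ 2.
Definition q1 : laurent := q1h ^+ 2.

Lemma q_unit : [/\ q \is a GRing.unit, q0 \is a GRing.unit & q1 \is a GRing.unit].
Proof. by split; rewrite unitrX ?lmon_unit. Qed.

Lemma lbar_q : [/\ lbar q = q^-1, lbar q0 = q0^-1 & lbar q1 = q1^-1].
Proof. by split; rewrite rmorphXn /= lbar_mon exprVn. Qed.

(* Z[q^{+-1}, q_0^{+-1}, q_1^{+-1}] *)
Definition laurent_int : set laurent :=
  smallest [set S : set laurent | subring_closed (mem S)]
    [set a | a \in [:: q; q^-1; q0; q0^-1; q1; q1^-1]].

Section Hecke.
Variable d : nat.
Local Notation A := laurent.
Local Notation I := 'I_d.+1.

(* Coxeter matrix of type C~_d for d >= 2 *)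
Definition coxm (i j : I) : nat :=
  if i == j then 1
  else if (i.+1 < j)%N || (j.+1 < i)%N then 2
  else if (minn i j == 0) || (maxn i j == d) then 4
  else 3.

Definition alt_word (i j : I) (m : nat) : seq I :=
  mkseq (fun k => if odd k then j else i) m.

(* The quadratic relation reads (T_i - qpar i) (T_i + qs i) = 0, where
   qs i = q_{s_i}. *)
Definition qs (i : I) : A :=
  if i == 0 :> nat then q1 else if i == d :> nat then q0^-1 else q.
Definition qpar (i : I) : A :=
  if i == 0 :> nat then q0^-1 else if i == d :> nat then q1^-1 else q^-1.

(* The Hecke algebra is presented as the quotient of the formal expressions in
   the T_i, with scalars in A, by the smallest congruence containing the axioms
   of A-algebras, the quadratic relations and the braid relations. *)
Inductive hexp : Type :=
| hcst of A
| hgen of I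
| hadd of hexp & hexp
| hmul of hexp & hexp.

Definition hword (u : seq I) : hexp := foldr (fun i e => hmul (hgen i) e) (hcst 1) u.

Inductive heq : hexp -> hexp -> Prop :=
| heq_refl x : heq x x
| heq_sym x y : heq x y -> heq y x
| heq_trans x y z : heq x y -> heq y z -> heq x z
| heq_add x x' y y' : heq x x' -> heq y y' -> heq (hadd x y) (hadd x' y')
| heq_mul x x' y y' : heq x x' -> heq y y' -> heq (hmul x y) (hmul x' y')
| heq_addA x y z : heq (hadd x (hadd y z)) (hadd (hadd x y) z)
| heq_addC x y : heq (hadd x y) (hadd y x)
| heq_add0 x : heq (hadd (hcst 0) x) x
| heq_addN x : heq (hadd (hmul (hcst (- 1)) x) x) (hcst 0)
| heq_mulA x y z : heq (hmul x (hmul y z)) (hmul (hmul x y) z)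
| heq_mul1l x : heq (hmul (hcst 1) x) x
| heq_mul1r x : heq (hmul x (hcst 1)) x
| heq_mulDl x y z : heq (hmul (hadd x y) z) (hadd (hmul x z) (hmul y z))
| heq_mulDr x y z : heq (hmul x (hadd y z)) (hadd (hmul x y) (hmul x z))
| heq_cstD a b : heq (hcst (a + b)) (hadd (hcst a) (hcst b))
| heq_cstM a b : heq (hcst (a * b)) (hmul (hcst a) (hcst b))
| heq_cstC a x : heq (hmul (hcst a) x) (hmul x (hcst a))
| heq_quad i :
    heq (hmul (hadd (hgen i) (hcst (- qpar i))) (hadd (hgen i) (hcst (qs i))))
        (hcst 0)
| heq_braid i j :
    heq (hword (alt_word i j (coxm i j))) (hword (alt_word j i (coxm i j))).

HB.instance Definition _ := gen_eqMixin hexp.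
HB.instance Definition _ := gen_choiceMixin hexp.

(* Evaluation of expressions in a ring, given central scalars and elements
   satisfying the relations. *)
Section Eval.
Variables (B : pzRingType) (f : A -> B) (t : I -> B).

Fixpoint heval (e : hexp) : B :=
  match e with
  | hcst a => f a
  | hgen i => t i
  | hadd x y => heval x + heval y
  | hmul x y => heval x * heval y
  end.

Definition hecke_relations : Prop :=
  (forall i, (t i - f (qpar i)) * (t i + f (qs i)) = 0) /\
  (forall i j, \prod_(k <- alt_word i j (coxm i j)) t k
             = \prod_(k <- alt_word j i (coxm i j)) t k).

Hypotheses (fB : zmod_morphism f) (fM : monoid_morphism f).
Hypothesis fC : forall a x, f a * x = x * f a.
Hypothesis rel_t : hecke_relations.

Let f0 : f 0 = 0. Proof. by rewrite -(subrr 0) fB subrr. Qed.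
Let fN a : f (- a) = - f a. Proof. by rewrite -sub0r fB f0 sub0r. Qed.
Let fD a b : f (a + b) = f a + f b. Proof. by rewrite -{1}(opprK b) fB fN opprK. Qed.

Lemma heval_word u : heval (hword u) = \prod_(i <- u) t i.
Proof. by elim: u => [|i u /= ->]; rewrite ?big_nil ?big_cons//= fM.1. Qed.

Lemma heval_heq x y : heq x y -> heval x = heval y.
Proof.
elim=> {x y} //=.
- by move=> x y z _ -> _ ->.
- by move=> x x' y y' _ -> _ ->.
- by move=> x x' y y' _ -> _ ->.
- by move=> x y z; rewrite addrA.
- by move=> x y; rewrite addrC.
- by move=> x; rewrite f0 add0r.
- by move=> x; rewrite fN f0 fM.1 mulN1r addNr.
- by move=> x y z; rewrite mulrA.
- by move=> x; rewrite fM.1 mul1r.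
- by move=> x; rewrite fM.1 mulr1.
- by move=> x y z; rewrite mulrDl.
- by move=> x y z; rewrite mulrDr.
- by move=> a b; rewrite fM.2.
- by move=> i; rewrite fN f0; exact: rel_t.1.
- by move=> i j; rewrite !heval_word; exact: rel_t.2.
Qed.

End Eval.

Definition heqb : rel hexp := fun x y => `[< heq x y >].
Lemma heqb_equiv : equiv_class_of heqb.
Proof.
split=> [x|x y|y x z].
- exact/asboolP/heq_refl.
- by apply/asboolP/asboolP; apply: heq_sym.
- by move=> /asboolP xy /asboolP yz; apply/asboolP; apply: heq_trans xy yz.
Qed.
Canonical heqb_equiv_rel := EquivRelPack heqb_equiv.

Definition hecke : Type := {eq_quot heqb_equiv_rel}%qT.
HB.instance Definition _ := Choice.on hecke.

Definition hclass (e : hexp) : hecke := (\pi_({eq_quot heqb_equiv_rel}) e)%qT.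
Definition hrep (x : hecke) : hexp := repr (x : {eq_quot heqb_equiv_rel}%qT).

Lemma hclassP e e' : hclass e = hclass e' <-> heq e e'.
Proof.
by split=> [/eqmodP/asboolP//|?]; apply/eqmodP/asboolP.
Qed.

Lemma hrepK x : hclass (hrep x) = x.
Proof. exact: reprK. Qed.

Lemma hrep_class e : heq (hrep (hclass e)) e.
Proof. by apply/hclassP; rewrite hrepK. Qed.

Definition hk_add x y : hecke := hclass (hadd (hrep x) (hrep y)).
Definition hk_mul x y : hecke := hclass (hmul (hrep x) (hrep y)).
Definition hk_opp x : hecke := hclass (hmul (hcst (- 1)) (hrep x)).
Definition hk_cst a : hecke := hclass (hcst a).

Lemma hk_addE e e' : hk_add (hclass e) (hclass e') = hclass (hadd e e').
Proof. by apply/hclassP/heq_add; apply: hrep_class. Qed.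
Lemma hk_mulE e e' : hk_mul (hclass e) (hclass e') = hclass (hmul e e').
Proof. by apply/hclassP/heq_mul; apply: hrep_class. Qed.
Lemma hk_oppE e : hk_opp (hclass e) = hclass (hmul (hcst (- 1)) e).
Proof. by apply/hclassP/heq_mul; [apply: heq_refl | apply: hrep_class]. Qed.

Let hkE := (hk_addE, hk_mulE, hk_oppE).

Lemma hk_addA : associative hk_add.
Proof.
move=> x y z; rewrite -(hrepK x) -(hrepK y) -(hrepK z) !hkE.
exact/hclassP/heq_addA.
Qed.
Lemma hk_addC : commutative hk_add.
Proof. by move=> x y; rewrite -(hrepK x) -(hrepK y) !hkE; exact/hclassP/heq_addC. Qed.
Lemma hk_add0 : left_id (hk_cst 0) hk_add.
Proof. by move=> x; rewrite -(hrepK x) hkE; exact/hclassP/heq_add0. Qed.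
Lemma hk_addN : left_inverse (hk_cst 0) hk_opp hk_add.
Proof. by move=> x; rewrite -(hrepK x) !hkE; exact/hclassP/heq_addN. Qed.
Lemma hk_mulA : associative hk_mul.
Proof.
move=> x y z; rewrite -(hrepK x) -(hrepK y) -(hrepK z) !hkE.
exact/hclassP/heq_mulA.
Qed.
Lemma hk_mul1 : left_id (hk_cst 1) hk_mul.
Proof. by move=> x; rewrite -(hrepK x) hkE; exact/hclassP/heq_mul1l. Qed.
Lemma hk_mulr1 : right_id (hk_cst 1) hk_mul.
Proof. by move=> x; rewrite -(hrepK x) hkE; exact/hclassP/heq_mul1r. Qed.
Lemma hk_mulDl : left_distributive hk_mul hk_add.
Proof.
move=> x y z; rewrite -(hrepK x) -(hrepK y) -(hrepK z) !hkE.
exact/hclassP/heq_mulDl.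
Qed.
Lemma hk_mulDr : right_distributive hk_mul hk_add.
Proof.
move=> x y z; rewrite -(hrepK x) -(hrepK y) -(hrepK z) !hkE.
exact/hclassP/heq_mulDr.
Qed.

Lemma hecke_relations_qpar : hecke_relations id qpar.
Proof.
split=> [i|i j]; first by rewrite subrr mul0r.
rewrite /coxm; case: eqVneq => [->//|ij].
case: ifP => _; first by rewrite /= !big_cons !big_nil; ring.
case: ifPn => [_|]; first by rewrite /= !big_cons !big_nil; ring.
move=> h; rewrite /= !big_cons; suff -> : qpar i = qpar j by [].
have := ltn_ord i; have := ltn_ord j => lj li; move: h; rewrite negb_or.
case/andP=> hm hM; rewrite /qpar.
have [->/= ->] : (i == 0 :> nat) = false /\ (j == 0 :> nat) = false.
  by split; apply: contraNF hm => /eqP ->; rewrite ?min0n ?minn0.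
have [->/= ->//] : (i == d :> nat) = false /\ (j == d :> nat) = false.
split; apply: contraNF hM => /eqP ->.
  by rewrite (maxn_idPl _)// -ltnS.
by rewrite (maxn_idPr _)// -ltnS.
Qed.

Lemma hk_1_neq0 : hk_cst 1 != hk_cst 0.
Proof.
apply/eqP => /hclassP/(@heval_heq A id qpar); rewrite /= => h.
have : (1 : A) = 0; last by apply/eqP/oner_neq0.
by apply: h => //; [exact: mulrC | exact: hecke_relations_qpar].
Qed.

HB.instance Definition _ := GRing.isNzRing.Build hecke
  hk_addA hk_addC hk_add0 hk_addN hk_mulA hk_mul1 hk_mulr1 hk_mulDl hk_mulDr
  hk_1_neq0.

Definition hk_scale (a : A) (x : hecke) : hecke := hk_mul (hk_cst a) x.

Lemma hk_cstD a b : hk_cst (a + b) = hk_cst a + hk_cst b.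
Proof. by rewrite [RHS]hk_addE; exact/hclassP/heq_cstD. Qed.
Lemma hk_cstM a b : hk_cst (a * b) = hk_cst a * hk_cst b.
Proof. by rewrite [RHS]hk_mulE; exact/hclassP/heq_cstM. Qed.
Lemma hk_cstC a (x : hecke) : hk_cst a * x = x * hk_cst a.
Proof.
by rewrite -(hrepK x) [LHS]hk_mulE [RHS]hk_mulE; exact/hclassP/heq_cstC.
Qed.

Lemma hk_scaleA a b x : hk_scale a (hk_scale b x) = hk_scale (a * b) x.
Proof. by rewrite /hk_scale hk_cstM; exact: mulrA. Qed.
Lemma hk_scale1 : left_id 1 hk_scale.
Proof. exact: mul1r. Qed.
Lemma hk_scaleDr : right_distributive hk_scale +%R.
Proof. by move=> a x y; apply: mulrDr. Qed.
Lemma hk_scaleDl x : {morph hk_scale^~ x : a b / a + b}.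
Proof. by move=> a b; rewrite /hk_scale hk_cstD; apply: mulrDl. Qed.

HB.instance Definition _ := GRing.Zmodule_isLmodule.Build A hecke
  hk_scaleA hk_scale1 hk_scaleDr hk_scaleDl.

Lemma hk_scaleAl (a : A) (x y : hecke) : a *: (x * y) = (a *: x) * y.
Proof. exact: mulrA. Qed.

HB.instance Definition _ := GRing.Lmodule_isLalgebra.Build A hecke hk_scaleAl.

Lemma hk_scaleAr (a : A) (x y : hecke) : a *: (x * y) = x * (a *: y).
Proof.
change (hk_cst a * (x * y) = x * (hk_cst a * y)).
by rewrite mulrA hk_cstC -mulrA.
Qed.

HB.instance Definition _ := GRing.Lalgebra_isAlgebra.Build A hecke hk_scaleAr.

Lemma hk_cstE a : hk_cst a = a%:A.
Proof. by rewrite -[LHS]mulr1. Qed.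

Definition hT (i : I) : hecke := hclass (hgen i).

Lemma hT_relations : hecke_relations (fun a => a%:A : hecke) hT.
Proof.
have wordE u : hclass (hword u) = \prod_(k <- u) hT k.
  elim: u => [|i u IH]; first by rewrite big_nil.
  by rewrite big_cons -IH [RHS]hk_mulE.
split=> [i|i j]; last by rewrite -!wordE; exact/hclassP/heq_braid.
rewrite -scaleNr -!hk_cstE.
by rewrite /hk_cst [X in X * _]hk_addE [X in _ * X]hk_addE [LHS]hk_mulE; exact/hclassP/heq_quad.
Qed.

(* Universal property *)
Section Lift.
Variables (B : pzRingType) (f : A -> B) (t : I -> B).
Definition hlift (x : hecke) : B := heval f t (hrep x).

Hypotheses (fB : zmod_morphism f) (fM : monoid_morphism f).
Hypothesis fC : forall a x, f a * x = x * f a.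
Hypothesis rel_t : hecke_relations f t.

Lemma hlift_class e : hlift (hclass e) = heval f t e.
Proof. exact/(heval_heq fB fM fC rel_t)/hrep_class. Qed.

Lemma hliftT i : hlift (hT i) = t i.
Proof. exact: hlift_class. Qed.

Lemma hlift_cst a : hlift a%:A = f a.
Proof. by rewrite -hk_cstE; exact: hlift_class. Qed.

Lemma hlift_is_monoid_morphism : monoid_morphism hlift.
Proof.
split=> [|x y]; first by rewrite -fM.1; exact: hlift_class.
by rewrite -(hrepK x) -(hrepK y) [_ * _]hk_mulE !hlift_class.
Qed.

Lemma hlift_is_zmod_morphism : zmod_morphism hlift.
Proof.
have hD x y : hlift (x + y) = hlift x + hlift y.
  by rewrite -(hrepK x) -(hrepK y) [_ + _]hk_addE !hlift_class.
by move=> x y; have := hD (x - y) y; rewrite subrK => ->; rewrite addrK.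
Qed.

End Lift.

Lemma hecke_ind (P : hecke -> Prop) :
  (forall a, P a%:A) -> (forall i, P (hT i)) ->
  (forall x y, P x -> P y -> P (x + y)) ->
  (forall x y, P x -> P y -> P (x * y)) -> forall x, P x.
Proof.
move=> Pc Pt Pa Pm x; rewrite -(hrepK x).
elim: (hrep x) => [a|i|e1 h1 e2 h2|e1 h1 e2 h2].
- by have := Pc a; rewrite -hk_cstE.
- exact: Pt.
- by have := Pa _ _ h1 h2; rewrite [_ + _]hk_addE.
- by have := Pm _ _ h1 h2; rewrite [_ * _]hk_mulE.
Qed.

Lemma qs_unit i : qs i \is a GRing.unit.
Proof. by have [u u0 u1] := q_unit; rewrite /qs; do 2?case: ifP; rewrite ?unitrV. Qed.
Lemma qpar_unit i : qpar i \is a GRing.unit.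
Proof. by have [u u0 u1] := q_unit; rewrite /qpar; do 2?case: ifP; rewrite unitrV. Qed.
Lemma lbar_qs i : lbar (qs i) = (qs i)^-1.
Proof.
have [u u0 u1] := q_unit; have [e e0 e1] := lbar_q.
by rewrite /qs; do 2?case: ifP; rewrite ?rmorphV//= ?e ?e0 ?e1.
Qed.
Lemma lbar_qpar i : lbar (qpar i) = (qpar i)^-1.
Proof.
have [u u0 u1] := q_unit; have [e e0 e1] := lbar_q.
by rewrite /qpar; do 2?case: ifP; rewrite rmorphV//= ?e ?e0 ?e1.
Qed.

(* T_i^{-1} *)
Definition hTinv (i : I) : hecke :=
  (qpar i * qs i)^-1 *: (hT i - (qpar i - qs i)%:A).

Lemma hTsq i : hT i * hT i = (qpar i - qs i) *: hT i + (qpar i * qs i)%:A.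
Proof.
have := hT_relations.1 i; rewrite mulrDr !mulrBl !mulr_algl !mulr_algr scalerA.
move=> /eqP h; apply/eqP; rewrite -subr_eq0 scalerBl.
by rewrite !opprD opprK !addrA; rewrite !addrA in h.
Qed.

Lemma hTinvT i : hTinv i * hT i = 1.
Proof.
rewrite /hTinv -scalerAl mulrBl mulr_algl hTsq addrAC subrr add0r scalerA.
by rewrite mulVr ?scale1r// unitrMl ?qs_unit// qpar_unit.
Qed.

Lemma hTTinv i : hT i * hTinv i = 1.
Proof.
rewrite /hTinv -scalerAr mulrBr mulr_algr hTsq addrAC subrr add0r scalerA.
by rewrite mulVr ?scale1r// unitrMl ?qs_unit// qpar_unit.
Qed.

Definition hTword (u : seq I) : hecke := \prod_(i <- u) hT i.
Definition hTinvword (u : seq I) : hecke := \prod_(i <- u) hTinv i.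

Lemma hTinvwordK u : hTinvword u * hTword (rev u) = 1 /\
  hTword (rev u) * hTinvword u = 1.
Proof.
rewrite /hTword /hTinvword; elim: u => [|i u [IH1 IH2]].
  by rewrite !big_nil mulr1.
rewrite rev_cons -cats1 big_cat big_cons big_seq1 /=; split.
  by rewrite mulrA -(mulrA (hTinv i)) IH1 mulr1 hTinvT.
by rewrite mulrA -(mulrA _ (hT i)) hTTinv mulr1 IH2.
Qed.

Lemma rev_alt_word i j m :
  rev (alt_word i j m) = if odd m then alt_word i j m else alt_word j i m.
Proof.
apply: (@eq_from_nth _ i); first by case: ifP; rewrite size_rev !size_mkseq.
rewrite size_rev size_mkseq => k km.
have mk : (m - k.+1 < m)%N by lia.
rewrite nth_rev size_mkseq// nth_mkseq// oddB//=.
by case: (odd m); rewrite /alt_word nth_mkseq//=; case: (odd k).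
Qed.

Lemma coxmC i j : coxm i j = coxm j i.
Proof. by rewrite /coxm eq_sym orbC minnC maxnC. Qed.

Lemma hTinv_relations : hecke_relations (fun a => (lbar a)%:A : hecke) hTinv.
Proof.
split=> [i|i j]; last first.
  have [x1 x2] := hTinvwordK (alt_word i j (coxm i j)).
  have [y1 y2] := hTinvwordK (alt_word j i (coxm i j)).
  have e : hTword (rev (alt_word i j (coxm i j))) =
           hTword (rev (alt_word j i (coxm i j))).
    by rewrite !rev_alt_word; case: ifP => _; rewrite /hTword hT_relations.2.
  change (hTinvword (alt_word i j (coxm i j)) =
          hTinvword (alt_word j i (coxm i j))).
  by rewrite -[LHS]mulr1 -y2 -e mulrA x1 mul1r.
have up := qpar_unit i; have us := qs_unit i.
rewrite lbar_qpar lbar_qs.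
have -> : hTinv i - ((qpar i)^-1)%:A =
          - (qpar i)^-1 *: (hTinv i * (hT i - (qpar i)%:A)).
  rewrite mulrBr hTinvT mulr_algr scaleNr scalerBr scalerA mulVr// scale1r.
  by rewrite opprB.
have -> : hTinv i + ((qs i)^-1)%:A = (qs i)^-1 *: ((hT i + (qs i)%:A) * hTinv i).
  by rewrite mulrDl hTTinv mulr_algl scalerDr scalerA mulVr// scale1r addrC.
rewrite -scalerAl -scalerAr mulrA -(mulrA (hTinv i)) hT_relations.1.
by rewrite mulr0 mul0r !scaler0.
Qed.

(* The bar involution: semilinear for [lbar], with T_i |-> T_i^{-1}.  By
   [hbar_word], it sends T_w to the inverse of T_{w^{-1}}. *)
Definition hbar : hecke -> hecke := hlift (fun a => (lbar a)%:A) hTinv.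

Let bar_zmod : zmod_morphism (fun a => (lbar a)%:A : hecke).
Proof. by move=> a b; rewrite rmorphB scalerBl. Qed.
Let bar_monoid : monoid_morphism (fun a => (lbar a)%:A : hecke).
Proof.
split=> [|a b]; first by rewrite rmorph1 scale1r.
by rewrite rmorphM mulr_algl scalerA.
Qed.
Let bar_central a (x : hecke) : (lbar a)%:A * x = x * (lbar a)%:A.
Proof. by rewrite mulr_algl mulr_algr. Qed.

HB.instance Definition _ := GRing.isZmodMorphism.Build hecke hecke hbar
  (hlift_is_zmod_morphism bar_zmod bar_monoid bar_central hTinv_relations).
HB.instance Definition _ := GRing.isMonoidMorphism.Build hecke hecke hbar
  (hlift_is_monoid_morphism bar_zmod bar_monoid bar_central hTinv_relations).

Lemma hbarT i : hbar (hT i) = hTinv i.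
Proof. exact: (hliftT bar_zmod bar_monoid bar_central hTinv_relations). Qed.

Lemma hbarZ a x : hbar (a *: x) = lbar a *: hbar x.
Proof.
rewrite -[in LHS]mulr_algl rmorphM -[RHS]mulr_algl; congr (_ * _).
exact: (hlift_cst bar_zmod bar_monoid bar_central hTinv_relations).
Qed.

Lemma hbar_word u :
  hbar (hTword u) * hTword (rev u) = 1 /\ hTword (rev u) * hbar (hTword u) = 1.
Proof.
suff -> : hbar (hTword u) = hTinvword u by exact: hTinvwordK.
by rewrite rmorph_prod; apply: eq_bigr => i _; exact: hbarT.
Qed.

Lemma hbarK : involutive hbar.
Proof.
elim/hecke_ind => [a|i|x y hx hy|x y hx hy].
- by rewrite !hbarZ !rmorph1 lbarK.
- have h : hbar (hTinv i) * hTinv i = 1 by rewrite -hbarT -rmorphM hbarT hTinvT rmorph1.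
  by rewrite hbarT -[LHS]mulr1 -(hTinvT i) mulrA h mul1r.
- by rewrite !rmorphD /= hx hy.
- by rewrite !rmorphM /= hx hy.
Qed.

(* q_w and T_w *)
Definition qW (w : affC d) : A := \prod_(i <- rexpr w) qs i.
Definition hTW (w : affC d) : hecke := hTword (rexpr w).

(* T_X, for finite X; [\sum_(w \in X)] is 0 by convention on infinite supports *)
Definition hTset (X : set (affC d)) : hecke :=
  \sum_(w \in X) (qW w)^-1 *: hTW w.

(* The Z[q^{+-1}, q_0^{+-1}, q_1^{+-1}]-submodule generated by X *)
Definition int_span (X : set hecke) : set hecke :=
  smallest [set M : set hecke | M 0 /\
    forall a x y, laurent_int a -> M x -> M y -> M (a *: x + y)] X.

Section Double.
Variables (r : nat) (lam mu : {ffun 'I_r.+2 -> nat}).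

(* T^g_{lambda mu} and H_{lambda mu} *)
Definition hTd (g : affC d) : hecke := hTset (dcoset lam g mu).

Definition Hd : set hecke := int_span [set hTd g | g in Ddouble lam mu].

End Double.
End Hecke.

(* Main.v *)
Require Import Defs.
From mathcomp Require Import all_boot all_order all_algebra.
From mathcomp Require Import finmap.
From mathcomp Require Import boolp classical_sets cardinality fsbigop.
From mathcomp Require Import zify ring.

(** The element T_X attached to a double coset X = W_J g W_K is, up to a scalar,
    determined by two facts: it is supported on X, and the generators of W_J
    (on the left) and of W_K (on the right) act on it by the eigenvalue [qpar].
    Indeed, if h = sum of the a_w T_w, then T_s h = (qpar s) h says exactly that
    q_w a_w does not change when w is replaced by s w ([eigen_lP], [eigen_rP]);
    so an eigenvector in this sense has coefficients proportional to those of
    T_X on every double coset X, and it is a combination of the T_X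
    ([eigen_span]).

    The bar involution sends T_s to its inverse and [qpar s] to its inverse, so
    it preserves the eigenvectors ([eigen_bar]).  Moreover the bar image of T_v
    is supported on the w <= v, has integral coefficients, and its coefficient
    at v is the product of the 1 / (qpar s * qs s) along a reduced expression of
    v ([tcoef_bar_word]).  Hence the bar image of T_X is a combination of
    elements T_Y.  If y is the minimal element of such a Y then y <= v for some
    v in X, and therefore y <= g ([dmin_bruhat]).  The coefficient of T_X itself
    is read off at a longest element v of X, where only T_v contributes; it is
    the product of the qs s / qpar s along a reduced expression of v
    ([bar_double_coset], [bar_scalar_expr]).  The bar invariance of the
    normalized x_mu is the case g = 1, J = K, in which no smaller y exists.

    No finiteness of the parabolic subgroups is needed: if X is infinite, then
    T_X is 0 by convention, and the claims are trivial.

    These arguments rest on the theory of the Coxeter group W and of its Hecke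
    algebra.  For W, everything follows from the action on the integers.
    A reflection t is determined by one point that it moves ([reflection_eq]),
    and the sign of w(t x) - w(x), for x < t x, does not depend on x; this sign
    says whether w inverts t.  The only reflection inverted by a generator s is
    s itself ([inverts_sgen]), which yields the strong exchange condition
    ([strong_exchange]).  That the generators generate W follows from a descent
    argument on the sum of the squares of the g(p) - p for 1 <= p <= d
    ([dist_lt], [no_descent]).  If s and t are right descents of w, then w has a
    reduced expression ending with the longest word in s and t, by inspection of
    the few values of w that matter ([dihedral_rdesc]); Matsumoto's theorem
    follows ([matsumoto]).

    The linear independence of the T_w comes from the regular representation on
    the functions on W.  The left operators [lop s] and the right operators
    [rop t] commute ([lop_rop]); as the value of a function at w is, up to a
    unit, the value at 1 of its image under right operators, the braid relations
    need only be checked at 1, where they are those of W ([lops_braid]). *)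

Set Implicit Arguments.
Unset Strict Implicit.
Unset Printing Implicit Defensive.

Import Order.TTheory GRing.Theory Num.Theory.
Local Open Scope ring_scope.

(** * Affine permutations *)

Section Weyl.
Variable d : nat.
Hypothesis hd : (1 < d)%N.
Local Notation W := (affC d).
Local Notation D := (period d).
Implicit Types (g h w t : W) (x y k : int) (i j : 'I_d.+1).

Lemma affD g x : g (x + D) = g x + D.
Proof. by case: (affCP g). Qed.

Lemma affN g x : g (- x) = - g x.
Proof. by case: (affCP g). Qed.

Lemma affMD g x k : g (x + k * D) = g x + k * D.
Proof.
have nat_case (n : nat) y : g (y + n%:Z * D) = g y + n%:Z * D.
  elim: n => [|n IH]; first by rewrite mul0r !addr0.
  by rewrite -addn1 PoszD mulrDl mul1r addrA affD IH addrA.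
case: (intP k) => [|n|n]; [exact: (nat_case 0%N)|exact: nat_case|].
apply: (addIr (n.+1%:Z * D)); rewrite -nat_case.
by rewrite mulNr !subrK.
Qed.

Lemma aff_inj g : injective g.
Proof. by case: (affCP g) => /bij_inj. Qed.

Lemma aff_fix0 g k : g (k * D) = k * D.
Proof. 
have g0 : g 0 = 0 by have e : g 0 = - g 0 by [rewrite -affN oppr0]; lia.
by have := affMD g 0 k; rewrite add0r g0 add0r.
Qed.

(** The points d + 1 + k D are fixed, being the centres of symmetries that
    commute with the group. *)
Lemma aff_fix1 g k : g (d%:Z + 1 + k * D) = d%:Z + 1 + k * D.
Proof.
rewrite affMD; congr (_ + _).
have := affD g (- (d%:Z + 1)); rewrite affN.
have -> : - (d%:Z + 1) + D = d%:Z + 1 by rewrite /period; lia.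
by rewrite /period; lia.
Qed.

Lemma affmulE g h x : (g * h)%g x = g (h x). Proof. by []. Qed.
Lemma affVK g x : g^-1%g (g x) = x.
Proof. by rewrite -affmulE mulVg. Qed.
Lemma affKV g x : g (g^-1%g x) = x.
Proof. by rewrite -affmulE mulgV. Qed.

(** The segment from 0 to d + 1 is a fundamental domain for the translations by
    the period and negation. *)
Lemma fund_domain x : exists k y, [/\ 0 <= y, y <= d%:Z + 1
  & x = y + k * D \/ x = - y + k * D].
Proof.
have D0 : D != 0 by rewrite /period; lia.
have := divz_eq x D; have := modz_ge0 x D0; have := ltz_mod x D0.
set m := (x %% D)%Z; set k := (x %/ D)%Z => m1 m0 e.
case: (leP m (d%:Z + 1)) => hm.
  by exists k, m; split=> //; left; rewrite addrC.
exists (k + 1), (D - m); rewrite mulrDl mul1r; split.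
- by move: m1; rewrite /period; lia.
- by move: hm; rewrite /period; lia.
- by right; rewrite {1}e; lia.
Qed.

(** Values of the generators on the fundamental domain; by [affMD] and [affN]
    they determine all the others. *)
Lemma sgen_fund i x : 0 <= x -> x <= d%:Z + 1 ->
  sgen i x = if i == 0 :> nat then (if x == 1 then -1 else x)
    else if i == d :> nat then (if x == d%:Z then d%:Z + 2 else x)
    else if x == i%:Z then i%:Z + 1 else if x == i%:Z + 1 then i%:Z else x.
Proof.
move=> x0 x1; rewrite sgenE; last by lia.
have small (n : int) : `|n| < D -> (D %| n)%Z = (n == 0).
  move=> h; apply/idP/eqP => [|->]; last exact: dvdz0.
  case/dvdzP => k e; case: (eqVneq k 0) => [k0|kn]; first by rewrite e k0 mul0r.
  have : D <= `|n| by rewrite e normrM ler_peMl //; move: kn; rewrite /period; lia.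
  by move: h; lia.
rewrite /cswap_fun /sgen_pair !eqz_mod_dvd.
have li := ltn_ord i.
case: eqP => i0 /=; last case: eqP => id /=.
- rewrite !small; do ?[by rewrite /period; lia].
  by case: (x =P 1) => [->|?]; do ?case: eqP; lia.
- rewrite !(small (x - d%:Z)) ?(small (x - (d%:Z + 2))) ?(small (x - - d%:Z)); 
    do ?[by rewrite /period; lia].
  case: (x =P d%:Z) => [->|xd]; first by case: eqP; lia.
  have -> : x - - (d%:Z + 2) = (x - d%:Z) + D by rewrite /period; lia.
  rewrite rpredDr ?dvdzz// small; last by rewrite /period; lia.
  by do ?case: eqP; lia.
- rewrite !small; do ?[by rewrite /period; lia].
  by case: (x =P i%:Z) => [->|?]; do ?case: eqP; lia.
Qed.

End Weyl.

(** * Reflections *)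

Section Reflections.
Variable d : nat.
Hypothesis hd : (1 < d)%N.
Local Notation W := (affC d).
Local Notation D := (period d).
Implicit Types (g h w t : W) (x y k : int) (i j : 'I_d.+1).

(** The points moved by a generator form one orbit [p + kD], [- p + kD],
    [sgen i p + kD], [- sgen i p + kD]. *)
Lemma sgen_moves i : exists p : int, sgen i p != p /\
  forall x, sgen i x != x -> exists k, [\/ x = p + k * D, x = - p + k * D,
     x = sgen i p + k * D | x = - sgen i p + k * D].
Proof.
have li := ltn_ord i.
exists (if i == 0 :> nat then 1 else i%:Z); split.
  rewrite sgen_fund//; do 2?case: eqP; do 3?case: eqP; lia.
move=> x hx; have [k [y [y0 y1 e]]] := fund_domain hd x; exists k.
have {}hx : sgen i y != y.
  move: hx; case: e => ->; rewrite affMD ?affN; first by rewrite (inj_eq (addIr _)).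
  by rewrite (inj_eq (addIr _)) eqr_opp.
move: hx; rewrite !sgen_fund//; try by case: eqP; lia.
case: (i =P 0 :> nat) => i0; first case: (y =P 1) => [e1|?]; try by rewrite eqxx.
  by move=> _; case: e => ->; rewrite e1; [constructor 1|constructor 2].
case: (i =P d :> nat) => id; first case: (y =P d%:Z) => [e1|?]; try by rewrite eqxx.
  by move=> _; case: e => ->; rewrite e1 id; [constructor 1|constructor 2].
rewrite eqxx; case: (y =P i%:Z) => [e1|?]; last case: (y =P i%:Z + 1) => [e1|?];
  last by rewrite eqxx.
  by move=> _; case: e => ->; rewrite e1; [constructor 1|constructor 2].
by move=> _; case: e => ->; rewrite e1; [constructor 3|constructor 4].
Qed.

Lemma sgenK i : (sgen i * sgen i = 1)%g.
Proof.
have li := ltn_ord i.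
apply: affC_ext => x; rewrite affmulE /=.
have [k [y [y0 y1 e]]] := fund_domain hd x.
suff h : sgen i (sgen i y) = y by case: e => ->; rewrite !(affMD, affN) h.
rewrite (sgen_fund hd i y0 y1); case: eqP => i0.
  case: eqP => [->|?]; last by rewrite sgen_fund// i0/=; case: eqP; lia.
  by rewrite affN sgen_fund ?i0//; lia.
case: eqP => id.
  case: eqP => [->|?]; last first.
    by rewrite sgen_fund// id eqxx; do 2?case: eqP; lia.
  have -> : d%:Z + 2 = - d%:Z + 1 * D by rewrite /period; lia.
  rewrite affMD affN sgen_fund ?id ?eqxx; try by lia.
  by case: eqP; rewrite /period; lia.
have /eqP i0' := i0; have /eqP id' := id.
case: eqP => [->|?]; last case: eqP => [->|?]; 
  rewrite sgen_fund ?(negPf i0') ?(negPf id')//; do ?case: eqP; lia.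
Qed.

Lemma sgenKf i x : sgen i (sgen i x) = x.
Proof. by rewrite -affmulE sgenK. Qed.

Lemma sgenV i : (sgen i)^-1%g = sgen i.
Proof. by apply: (mulgI (sgen i)); rewrite mulgV sgenK. Qed.

Lemma reflectionK t x : reflection t -> t (t x) = x.
Proof. by case=> w [i ->]; rewrite !affmulE affVK sgenKf affKV. Qed.

Lemma reflection_moves t : reflection t -> exists p : int, t p != p /\
  forall x, t x != x -> exists k, [\/ x = p + k * D, x = - p + k * D,
     x = t p + k * D | x = - t p + k * D].
Proof.
case=> w [i ->]; have [p [p0 ph]] := sgen_moves i; exists (w p).
rewrite !affmulE !affVK (inj_eq (@aff_inj _ _)); split=> // x hx.
have [|k hk] := ph (w^-1%g x).
  by apply: contraNneq hx; rewrite !affmulE => ->; rewrite affKV.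
exists k; have -> : x = w (w^-1%g x) by rewrite affKV.
by case: hk => ->; rewrite affMD ?affN;
  [constructor 1|constructor 2|constructor 3|constructor 4].
Qed.

Lemma reflection_orbit t x y : reflection t -> t x != x -> t y != y ->
  exists k, [\/ y = x + k * D, y = - x + k * D, y = t x + k * D | y = - t x + k * D].
Proof.
move=> rt hx hy; have [p [p0 ph]] := reflection_moves rt.
have [k hk] := ph _ hx; have [l hl] := ph _ hy.
have tt := reflectionK p rt.
have [e [e' [ex etx sg]]] : exists e e', [/\ x = e + k * D, t x = e' + k * D &
   (e = p /\ e' = t p \/ e = - p /\ e' = - t p) \/
   (e = t p /\ e' = p \/ e = - t p /\ e' = - p)].
  case: hk => ->; rewrite affMD ?affN ?tt; do 2!eexists; split; try reflexivity; tauto.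
rewrite etx ex; move: hl {hk ph hx hy etx ex}.
case: sg => [] [] [-> ->] [] ->; 
 first [exists (l - k); rewrite mulrBl; by [constructor 1; lia|constructor 2; lia
   |constructor 3; lia|constructor 4; lia]
 | exists (l + k); rewrite mulrDl; by [constructor 1; lia|constructor 2; lia
   |constructor 3; lia|constructor 4; lia]].
Qed.

(** A reflection is determined by its value at a single moved point. *)
Lemma reflection_eq t t' x : reflection t -> reflection t' -> t x != x ->
  t' x = t x -> t = t'.
Proof.
move=> rt rt' hx e; have hx' : t' x != x by rewrite e.
apply: affC_ext => y.
have [ty|ty] := eqVneq (t y) y; last first.
  have [k hk] := reflection_orbit rt hx ty.
  by case: hk => ->; rewrite !affMD ?affN ?e// -{2}e !reflectionK.
rewrite ty; have [->//|ty'] := eqVneq (t' y) y.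
have [k hk] := reflection_orbit rt' hx' ty'; move: ty.
by case: hk => ->; rewrite !affMD ?affN ?e// => <-; rewrite -{2}e !reflectionK.
Qed.

(** [w] inverts the reflection [t]: it reverses the order of the two ends of
    some pair exchanged by [t].  By [invertsE] every such pair then works. *)
Definition inverts w t : Prop := exists2 x : int, x < t x & w (t x) < w x.

Lemma invertsE w t x : reflection t -> x < t x ->
  inverts w t <-> w (t x) < w x.
Proof.
move=> rt hx; split=> [[y hy hw]|hw]; last by exists x.
have nx : t x != x by lia.
have ny : t y != y by lia.
have [k hk] := reflection_orbit rt ny nx.
by move: hx {nx ny}; case: hk => ->; rewrite !affMD ?affN ?reflectionK ?affMD ?affN//; lia.
Qed.

Lemma reflection_up t : reflection t -> exists x, x < t x.
Proof.
move=> rt; have [p [p0 _]] := reflection_moves rt.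
have [h|h] := ltP p (t p); first by exists p.
by exists (t p); rewrite reflectionK//; lia.
Qed.

Lemma reflection_sgen i : reflection (sgen i).
Proof. by exists 1%g, i; rewrite mul1g invg1 mulg1. Qed.

Lemma reflectionJ t w : reflection t -> reflection (w * t * w^-1)%g.
Proof. by case=> v [i ->]; exists (w * v)%g, i; rewrite invgM !mulgA. Qed.

Lemma reflectionJs t i : reflection t -> reflection (sgen i * t * sgen i)%g.
Proof. by rewrite -{2}(sgenV i); apply: reflectionJ. Qed.

(** Distinct multiples of the period are at least one period apart, in a form
    that linear arithmetic can use. *)
Lemma period_gap (k j : int) : [\/ k = j, k * D + D <= j * D | j * D + D <= k * D].
Proof.
have D0 : 0 < D by rewrite /period; lia.
have step (a b : int) : a < b -> a * D + D <= b * D.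
  move=> ab; have : (a + 1) * D <= b * D by rewrite ler_pM2r//; lia.
  by rewrite mulrDl mul1r.
by case: (ltgtP k j) => h; [constructor 2|constructor 3|constructor 1]; auto.
Qed.

(** An end generator exchanges the two neighbours of each point of a class
    [c + kD] of points that are fixed by the whole group. *)
Lemma sgen_end i : i = 0 :> nat \/ i = d :> nat ->
  exists c : int, (forall g k, g (c + k * D) = c + k * D) /\
   forall x, exists k, [\/ x = c + k * D - 1 /\ sgen i x = c + k * D + 1,
     x = c + k * D + 1 /\ sgen i x = c + k * D - 1 | sgen i x = x].
Proof.
move=> hi; exists (if i == 0 :> nat then 0 else d%:Z + 1); split=> [g k|x].
  by case: ifP => _; [rewrite add0r aff_fix0|rewrite (aff_fix1 hd)].
have [k [y [y0 y1 e]]] := fund_domain hd x.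
case: (i =P 0 :> nat) => i0.
  exists k; case: e => ->; rewrite affMD ?affN sgen_fund// i0 /=;
  case: eqP => [->|?]; [constructor 2|constructor 3|constructor 1|constructor 3]; lia.
have {hi} id : i = d :> nat by lia.
case: e => ->; [exists k|exists (k - 1)]; rewrite affMD ?affN sgen_fund//;
  rewrite ?mulrBl id eqxx; (case: eqP => [?|_]; first by lia);
  case: eqP => [->|?]; [constructor 1|constructor 3|constructor 2|constructor 3];
  rewrite /period; lia.
Qed.

Lemma sgen_mid i x : i <> 0 :> nat -> i <> d :> nat -> x - 1 <= sgen i x <= x + 1.
Proof.
move=> i0 id; have [k [y [y0 y1 e]]] := fund_domain hd x.
case: e => ->; rewrite affMD ?affN sgen_fund//; do ?case: eqP; lia.
Qed.

(** The only reflection inverted by a simple generator is that generator. *)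
Lemma inverts_sgen i t : reflection t -> inverts (sgen i) t <-> t = sgen i.
Proof.
move=> rt; split=> [[x hx hs]|->]; last first.
  have [x hx] := reflection_up (reflection_sgen i).
  by exists x => //; rewrite sgenKf.
suff e : sgen i x = t x.
  by apply: (@reflection_eq _ _ x) => //; [exact: reflection_sgen|lia].
case: (boolP ((i == 0 :> nat) || (i == d :> nat))) => hi; last first.
  have i0 : i <> 0 :> nat by lia.
  have id : i <> d :> nat by lia.
  by have := sgen_mid x i0 id; have := sgen_mid (t x) i0 id; lia.
have [|c [cf hc]] := @sgen_end i; first by lia.
have [k hk] := hc x; have [l hl] := hc (t x).
have tk := cf t k; have tl := cf t l.
have nx : x <> c + k * D by move=> e; move: hx; rewrite e tk; lia.
have ny : t x <> c + l * D by move=> e; move: hx; rewrite -{1}(reflectionK x rt) e tl; lia.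
have nx' : x <> c + l * D by move=> e; move: hx; rewrite e tl; lia.
have ny' : t x <> c + k * D by move=> e; move: hx; rewrite -{1}(reflectionK x rt) e tk; lia.
(* [s] moves points by at most 2, across a fixed point [c + kD]; since [t] fixes
   these points as well, the pair (x, t x) can only be the pair exchanged by [s] *)
have D6 : 6 <= D by rewrite /period; lia.
have := period_gap k l.
case: hk => [[ex es]|[ex es]|es]; case: hl => [[ey et]|[ey et]|et] []; lia.
Qed.

(** The cocycle rule for inversions, with [inverts_mulr] for the excluded case *)
Lemma inverts_mulS w t i : reflection t -> t <> sgen i ->
  inverts (w * sgen i)%g t <-> inverts w (sgen i * t * sgen i)%g.
Proof.
move=> rt nt; have [x hx] := reflection_up rt.
have rt' := reflectionJs i rt.
have hs : sgen i x < sgen i (t x).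
  rewrite ltNge le_eqVlt; apply/negP => /orP[/eqP /aff_inj e|h]; first by lia.
  by apply: nt; apply/(inverts_sgen i rt); exists x.
rewrite (invertsE _ rt hx) (@invertsE _ _ (sgen i x) rt') !affmulE ?sgenKf//.
Qed.

Lemma inverts_mulr w t : reflection t -> inverts (w * t)%g t <-> ~ inverts w t.
Proof.
move=> rt; have [x hx] := reflection_up rt.
rewrite !(invertsE _ rt hx) !affmulE reflectionK//.
split; first by move=> ? ?; lia.
have : w x <> w (t x) by move/aff_inj; lia.
by lia.
Qed.

Lemma inverts1 t : reflection t -> ~ inverts 1%g t.
Proof. by move=> rt [x hx] /=; lia. Qed.

End Reflections.

(** * Length and the exchange condition *)

Section Length.
Variable d : nat.
Hypothesis hd : (1 < d)%N.
Local Notation W := (affC d).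
Local Notation D := (period d).
Local Notation word := (seq 'I_d.+1).
Implicit Types (g h w t : W) (x y k : int) (i j : 'I_d.+1) (u v : word).

Lemma word_val_nil : word_val [::] = 1%g :> W.
Proof. by rewrite /word_val big_nil. Qed.
Lemma word_val_cat u v : word_val (u ++ v) = (word_val u * word_val v)%g.
Proof. by rewrite /word_val big_cat. Qed.
Lemma word_val_cons i u : word_val (i :: u) = (sgen i * word_val u)%g.
Proof. by rewrite /word_val big_cons. Qed.
Lemma word_val1 i : word_val [:: i] = sgen i.
Proof. by rewrite /word_val big_seq1. Qed.
Lemma word_val_rcons u i : word_val (rcons u i) = (word_val u * sgen i)%g.
Proof. by rewrite -cats1 word_val_cat word_val1. Qed.
Lemma word_val_rev u : word_val (rev u) = (word_val u)^-1%g.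
Proof.
elim: u => [|i u IH]; first by rewrite word_val_nil invg1.
by rewrite rev_cons word_val_rcons IH word_val_cons invgM (sgenV hd).
Qed.

Let absz_sq_lt (a b : int) : (absz a < absz b)%N -> (absz a ^ 2 < absz b ^ 2)%N.
Proof. by rewrite ltn_exp2r. Qed.

Let absz_sq_swap (a b p : int) : b < a ->
  (absz (b - p)%R ^ 2 + absz (a - (p + 1))%R ^ 2 <
   absz (a - p)%R ^ 2 + absz (b - (p + 1))%R ^ 2)%N.
Proof.
have sq (x : int) : (absz x ^ 2)%N%:Z = x * x.
  by rewrite -abszX abszE ger0_norm ?sqr_ge0// expr2.
by move=> ba; rewrite -ltz_nat !PoszD !sq; nia.
Qed.

(* the squared distance from the window g(1), ..., g(d) to 1, ..., d *)
Let dist g : nat := (\sum_(p < d) absz (g (p%:Z + 1)%R - (p%:Z + 1))%R ^ 2)%N.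

(** Descents in terms of the window g(1), ..., g(d) *)
Lemma inverts_sgenE g i : inverts g (sgen i) <->
  [\/ (i = 0 :> nat /\ g 1 < 0), (i = d :> nat /\ d%:Z + 1 < g d%:Z)
    | [/\ i <> 0 :> nat, i <> d :> nat & g (i%:Z + 1) < g i%:Z]].
Proof.
have li := ltn_ord i.
have rs := reflection_sgen i.
case: (i =P 0 :> nat) => i0; last case: (i =P d :> nat) => id.
- have e : sgen i (-1) = 1 by rewrite affN sgen_fund// ?i0 ?eqxx ?opprK//; lia.
  rewrite (@invertsE _ hd _ _ (-1) rs) e// affN.
  have -> : (g 1 < - g 1) = (g 1 < 0) by lia.
  split; first by move=> h; constructor 1.
  by case=> [[]|[]|[]]; lia.
- have e : sgen i d%:Z = - d%:Z + 1 * D.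
    by rewrite sgen_fund// ?id ?eqxx; try lia; case: eqP; rewrite /period; lia.
  rewrite (@invertsE _ hd _ _ d%:Z rs); rewrite e ?affMD ?affN; last by rewrite /period; lia.
  split; first by move=> h; constructor 2; move: h; rewrite /period; lia.
  by case=> [[]|[]|[]]; rewrite /period; lia.
- have e : sgen i i%:Z = i%:Z + 1.
    by rewrite sgen_fund//; do 3?case: eqP; lia.
  rewrite (@invertsE _ hd _ _ i%:Z rs); rewrite e; last by lia.
  by split; [move=> h; constructor 3|case=> [[]|[]|[]]].
Qed.

Lemma dist_lt g i : inverts g (sgen i) -> (dist (g * sgen i)%g < dist g)%N.
Proof.
move/inverts_sgenE; have li := ltn_ord i.
have other (P : pred 'I_d) : (forall p : 'I_d, P p -> sgen i (p%:Z + 1) = p%:Z + 1) ->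
  (\sum_(p < d | P p) absz ((g * sgen i)%g (p%:Z + 1)%R - (p%:Z + 1))%R ^ 2)%N =
  (\sum_(p < d | P p) absz (g (p%:Z + 1)%R - (p%:Z + 1))%R ^ 2)%N.
  by move=> h; apply: eq_bigr => p hp; rewrite affmulE h.
case=> [[i0 h]|[id h]|[i0 id h]].
- have d0 : (0 < d)%N by lia.
  rewrite /dist (bigD1 (Ordinal d0))//= [X in (_ < X)%N](bigD1 (Ordinal d0))//= other;
    last first.
    move=> p hp; have lp := ltn_ord p; rewrite sgen_fund//; try by lia.
    rewrite i0 eqxx; case: eqP => // e; case/negP: hp; apply/eqP/val_inj => /=; lia.
  rewrite ltn_add2r /= sgen_fund// ?i0 ?eqxx ?add0r ?affN; try by lia.
  have neg (a : int) : a < 0 -> (absz (- a - 1)%R < absz (a - 1)%R)%N by lia.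
  exact/absz_sq_lt/neg.
- have d0 : (d.-1 < d)%N by lia.
  rewrite /dist (bigD1 (Ordinal d0))//= [X in (_ < X)%N](bigD1 (Ordinal d0))//= other;
    last first.
    move=> p hp; have lp := ltn_ord p; rewrite sgen_fund//; try by lia.
    rewrite id eqxx; do 2?case: eqP => // ?; first by lia.
    case/negP: hp; apply/eqP/val_inj => /=; lia.
  have -> : d.-1%:Z + 1 = d%:Z by lia.
  have e : sgen i d%:Z = - d%:Z + 1 * D.
    by rewrite sgen_fund// ?id ?eqxx; try lia; case: eqP; rewrite /period; lia.
  rewrite ltn_add2r /= e affMD affN.
  by apply: absz_sq_lt; move: h; rewrite /period; lia.
- have d0 : (i.-1 < d)%N by lia.
  have d1 : (i < d)%N by lia.
  have ne : Ordinal d1 != Ordinal d0 by apply/eqP => /(congr1 val) /=; lia.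
  rewrite /dist (bigD1 (Ordinal d0))//= [X in (_ < X)%N](bigD1 (Ordinal d0))//=.
  rewrite (bigD1 (Ordinal d1))//= [X in (_ < _ + X)%N](bigD1 (Ordinal d1))//= other;
    last first.
    move=> p /andP[hp hq]; have lp := ltn_ord p; rewrite sgen_fund//; try by lia.
    do 2?case: eqP => // ?.
    case: eqP => [e|?].
      case/negP: hp; apply/eqP/val_inj => /=; lia.
    case: eqP => // e; case/negP: hq; apply/eqP/val_inj => /=; lia.
  have -> : i.-1%:Z + 1 = i%:Z by lia.
  rewrite !addnA ltn_add2r.
  rewrite !sgen_fund//; try by lia.
  rewrite eqxx; do 2?(case: eqP => // _); case: eqP => [|_]; first by lia.
  by rewrite eqxx; apply: absz_sq_swap.
Qed.

(** Without descents, 0 < g(1) < ... < g(d) < d + 1, so that [g] is trivial. *)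
Lemma no_descent g : (forall i, ~ inverts g (sgen i)) -> g = 1%g.
Proof.
move=> h.
have d0 : (0 < d.+1)%N by lia.
have h0 : ~ (g 1 < 0).
  by move=> h1; apply: (h (Ordinal d0)); apply/inverts_sgenE; constructor 1.
have h1 : ~ (d%:Z + 1 < g d%:Z).
  by move=> h1; apply: (h ord_max); apply/inverts_sgenE; constructor 2.
have h2 (p : nat) : (0 < p)%N -> (p < d)%N -> g p%:Z < g (p%:Z + 1).
  move=> p0 pd; have pd' : (p < d.+1)%N by lia.
  have := h (Ordinal pd'); rewrite inverts_sgenE /= => hh.
  suff : ~ (g (p%:Z + 1) < g p%:Z).
    by have : g p%:Z <> g (p%:Z + 1) by [move/aff_inj; lia]; lia.
  by move=> hlt; apply: hh; constructor 3; split=> //; lia.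
have g00 : g 0 = 0 by have := aff_fix0 hd g 0; rewrite mul0r.
have gd1 : g (d%:Z + 1) = d%:Z + 1.
  by have := aff_fix1 hd g 0; rewrite mul0r addr0.
have g1 : 0 < g 1.
  have : g 1 <> 0 by move=> e; have /aff_inj : g 1 = g 0 by rewrite e g00.
  by lia.
have gd : g d%:Z < d%:Z + 1.
  have : g d%:Z <> d%:Z + 1.
    by move=> e; have /aff_inj : g d%:Z = g (d%:Z + 1) by [rewrite e gd1]; lia.
  by lia.
have up (p : nat) : (0 < p)%N -> (p <= d)%N -> p%:Z <= g p%:Z.
  elim: p => // p IH _ pd; case: p IH pd => [|p] IH pd; first by rewrite -gtz0_ge1.
  have := h2 p.+1 isT pd; have := IH isT (ltnW pd).
  have -> : p.+1%:Z + 1 = p.+2%:Z by lia.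
  by lia.
have dn (m : nat) : (m < d)%N -> g (d - m)%N%:Z <= (d - m)%N%:Z.
  elim: m => [|m IH] md; first by rewrite subn0; lia.
  have := IH (ltnW md); have := h2 (d - m.+1)%N.
  have -> : (d - m.+1)%N%:Z + 1 = (d - m)%N%:Z by lia.
  by lia.
have fix_ (p : nat) : (0 < p)%N -> (p <= d)%N -> g p%:Z = p%:Z.
  move=> p0 pd; have := up p p0 pd; have := dn (d - p)%N.
  have -> : (d - (d - p) = p)%N by lia.
  by lia.
apply: affC_ext => x; have [k [y [y0 y1 e]]] := fund_domain hd x.
suff gy : g y = y by case: e => ->; rewrite affMD ?affN gy.
have [->//|y0'] := eqVneq y 0.
have [->//|y1'] := eqVneq y (d%:Z + 1).
have -> : y = `|y|%N%:Z by lia.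
by apply: fix_; lia.
Qed.

Lemma word_val_surj g : exists u, word_val u = g.
Proof.
have [n] := ubnP (dist g); elim: n g => // n IH g hn.
have [[i hi]|no] := pselect (exists i, inverts g (sgen i)); last first.
  exists [::]; rewrite word_val_nil; symmetry; apply: no_descent => i hi.
  by apply: no; exists i.
have [|u hu] := IH (g * sgen i)%g; first exact: leq_trans (dist_lt hi) _.
by exists (rcons u i); rewrite word_val_rcons hu -mulgA (sgenK hd) mulg1.
Qed.

Lemma rexprP g : word_val (rexpr g) = g /\ reduced (rexpr g).
Proof.
rewrite /rexpr; case: xgetP => [u _ [? ?]//|no].
have ex : exists n, `[< exists2 u, word_val u = g & size u = n >].
  by have [u hu] := word_val_surj g; exists (size u); apply/asboolP; exists u.
case: (ex_minnP ex) => n /asboolP[u uv un] hmin.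
case: (no u); split=> // v vu; rewrite un; apply: hmin; apply/asboolP.
by exists v => //; rewrite vu.
Qed.

Lemma word_rexpr g : word_val (rexpr g) = g. Proof. by case: (rexprP g). Qed.

Lemma len_word u : (len (word_val u) <= size u)%N.
Proof. by case: (rexprP (word_val u)) => e; apply; rewrite e. Qed.

Lemma reducedE u : reduced u <-> len (word_val u) = size u.
Proof.
split=> [h|h v e]; last by rewrite -h -e; apply: len_word.
by apply/eqP; rewrite eqn_leq len_word /=; apply: h; rewrite word_rexpr.
Qed.

Lemma len1 : len (1%g : W) = 0%N.
Proof. by apply/eqP; rewrite -leqn0 -word_val_nil; apply: len_word. Qed.

Lemma lenV g : len g^-1%g = len g.
Proof.
have le h : (len h^-1%g <= len h)%N.
  by rewrite -{1}(word_rexpr h) -word_val_rev (leq_trans (len_word _))// size_rev.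
by apply/eqP; rewrite eqn_leq le -{1}(invgK g) le.
Qed.

Lemma lenM g h : (len (g * h)%g <= len g + len h)%N.
Proof.
rewrite -{1}(word_rexpr g) -{1}(word_rexpr h) -word_val_cat.
by rewrite (leq_trans (len_word _))// size_cat.
Qed.

Lemma len_sgen i : (len (sgen i) <= 1)%N.
Proof. by rewrite -word_val1; apply: len_word. Qed.

(** Strong exchange condition: an inverted reflection deletes one letter. *)
Lemma strong_exchange u t : reflection t -> inverts (word_val u) t ->
  exists u1 i u2, u = u1 ++ i :: u2 /\ (word_val u * t)%g = word_val (u1 ++ u2).
Proof.
elim/last_ind: u t => [|u i IH] t rt; first by rewrite word_val_nil => /(inverts1 hd rt).
rewrite word_val_rcons; have [->|nt] := pselect (t = sgen i).
  move=> _; exists u, i, [::]; rewrite cats1 cats0; split=> //.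
  by rewrite -mulgA (sgenK hd) mulg1.
move/(inverts_mulS hd _ rt nt) => h.
have [u1 [j [u2 [-> e]]]] := IH _ (reflectionJs hd i rt) h.
exists u1, j, (rcons u2 i); split; first by rewrite rcons_cat.
by rewrite -rcons_cat word_val_rcons -e -!mulgA (sgenK hd) mulg1.
Qed.

Lemma len_inverts g t : reflection t -> inverts g t <-> (len (g * t)%g < len g)%N.
Proof.
move=> rt; have dec h : inverts h t -> (len (h * t)%g < len h)%N.
  rewrite -{1}(word_rexpr h) => hh; have [u1 [i [u2 [e e']]]] := strong_exchange rt hh.
  rewrite word_rexpr in e'; rewrite e' (leq_ltn_trans (len_word _))//.
  by rewrite /len e !size_cat /= addnS.
split=> [/dec//|h]; have [//|n] := pselect (inverts g t).
have /dec : inverts (g * t)%g t by apply/(inverts_mulr hd).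
have -> : (g * t * t)%g = g; last by lia.
by apply: affC_ext => x; rewrite !affmulE (reflectionK hd).
Qed.

(** The generator [i] is a right descent of [g]. *)
Definition rdesc g i : bool := (len (g * sgen i)%g < len g)%N.

Lemma rdescP g i : rdesc g i <-> inverts g (sgen i).
Proof. by rewrite (len_inverts _ (reflection_sgen i)). Qed.

Lemma rdescS g i : rdesc (g * sgen i)%g i = ~~ rdesc g i.
Proof.
apply/idP/idP => [/rdescP/(inverts_mulr hd _ (reflection_sgen i))|/negP] h.
  by apply/negP => /rdescP.
by apply/rdescP/(inverts_mulr hd _ (reflection_sgen i)) => /rdescP.
Qed.

Lemma mulsK g i : (g * sgen i * sgen i)%g = g.
Proof. by rewrite -mulgA (sgenK hd) mulg1. Qed.
Lemma mulKs g i : (sgen i * (sgen i * g))%g = g.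
Proof. by rewrite mulgA (sgenK hd) mul1g. Qed.

Lemma len_mulS g i :
  if rdesc g i then len g = (len (g * sgen i)%g).+1
  else len (g * sgen i)%g = (len g).+1.
Proof.
have := lenM g (sgen i); have := lenM (g * sgen i)%g (sgen i).
have := rdescS g i; rewrite mulsK; have := len_sgen i; rewrite /rdesc mulsK; case: ifP; lia.
Qed.

Lemma rdesc_len g i : rdesc g i -> len g = (len (g * sgen i)%g).+1.
Proof. by move=> h; have := len_mulS g i; rewrite h. Qed.

Lemma rasc_len g i : ~~ rdesc g i -> len (g * sgen i)%g = (len g).+1.
Proof. by move=> h; have := len_mulS g i; rewrite (negPf h). Qed.

Lemma reduced_rcons u i : reduced (rcons u i) <-> reduced u /\ ~~ rdesc (word_val u) i.
Proof.
have := len_mulS (word_val u) i; have := len_word u.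
rewrite !reducedE word_val_rcons size_rcons; case: (rdesc _ _); lia.
Qed.

End Length.

(** * Matsumoto's theorem *)

Section Matsumoto.
Variable d : nat.
Hypothesis hd : (1 < d)%N.
Local Notation W := (affC d).
Local Notation D := (period d).
Local Notation word := (seq 'I_d.+1).
Implicit Types (g h w t : W) (x y k : int) (i j : 'I_d.+1) (u v : word).

Lemma rdesc_first g i : i = 0 :> nat -> rdesc g i = (g 1%:Z < 0).
Proof.
move=> i0; apply/idP/idP => [/(rdescP hd)/(inverts_sgenE hd)[[]|[]|[]] //|h]; try lia.
by apply/(rdescP hd)/(inverts_sgenE hd); constructor 1.
Qed.

Lemma rdesc_last g i : i = d :> nat -> rdesc g i = (d%:Z + 1 < g d%:Z).
Proof.
move=> i0; apply/idP/idP => [/(rdescP hd)/(inverts_sgenE hd)[[]|[]|[]] //|h]; try lia.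
by apply/(rdescP hd)/(inverts_sgenE hd); constructor 2.
Qed.

Lemma rdesc_mid g i : i <> 0 :> nat -> i <> d :> nat ->
  rdesc g i = (g (i%:Z + 1) < g i%:Z).
Proof.
move=> i0 id; apply/idP/idP => [/(rdescP hd)/(inverts_sgenE hd)[[]|[]|[]] //|h].
by apply/(rdescP hd)/(inverts_sgenE hd); constructor 3.
Qed.

Lemma sgen_first i : i = 0 :> nat -> sgen i 1%:Z = - 1%:Z.
Proof. by move=> i0; rewrite sgen_fund ?i0//; lia. Qed.

Lemma sgen_last i : i = d :> nat -> sgen i d%:Z = - d%:Z + 1 * D.
Proof.
by move=> id; rewrite sgen_fund ?id ?eqxx//; try lia; case: eqP; rewrite /period; lia.
Qed.

Lemma sgen_l i : i <> 0 :> nat -> i <> d :> nat -> sgen i i%:Z = i%:Z + 1.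
Proof.
have li := ltn_ord i.
by move=> i0 id; rewrite sgen_fund//; do 3?case: eqP; lia.
Qed.

Lemma sgen_r i : i <> 0 :> nat -> i <> d :> nat -> sgen i (i%:Z + 1) = i%:Z.
Proof.
have li := ltn_ord i.
by move=> i0 id; rewrite sgen_fund//; do 4?case: eqP; lia.
Qed.

Lemma sgen_fix i x : 0 <= x -> x <= d%:Z + 1 -> (i = 0 :> nat -> x <> 1) ->
  (x <> i%:Z) -> (i <> d :> nat -> i <> 0 :> nat -> x <> i%:Z + 1) -> sgen i x = x.
Proof.
by move=> x0 x1 h0 h1 h2; rewrite sgen_fund//; do 4?case: eqP; lia.
Qed.

(** Case analysis on the pairs of distinct generators, up to exchange: distant
    pairs, inner adjacent pairs, and the adjacent pairs at the two ends *)
Lemma coxm_sym_ind (P : 'I_d.+1 -> 'I_d.+1 -> nat -> Prop) :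
  (forall i j m, P i j m -> P j i m) ->
  (forall i j, (i.+1 < j)%N -> P i j 2) ->
  (forall i j, i <> 0 :> nat -> j <> d :> nat -> j = i.+1 :> nat -> P i j 3) ->
  (forall i j, i = 0 :> nat -> j = 1 :> nat -> P i j 4) ->
  (forall i j, i <> 0 :> nat -> j = d :> nat -> i.+1 = d :> nat -> P i j 4) ->
  forall i j, i != j -> P i j (coxm i j).
Proof.
move=> Psym P2 P3 P4 P4' i j; wlog ij : i j / (i < j)%N => [hw nij|_].
  case: (ltngtP i j) => [h|h|h]; first exact: hw.
    by rewrite coxmC; apply: Psym; apply: hw; rewrite // eq_sym.
  by case/eqP: nij; apply: val_inj.
have lj := ltn_ord j.
rewrite /coxm; case: eqP => [e|_]; first by rewrite e ltnn in ij.
case: ifP => [h|h]; first by apply: P2; lia.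
have ej : j = i.+1 :> nat by lia.
rewrite (minn_idPl _) 1?(maxn_idPr _); try lia.
case: (i =P 0 :> nat) => i0 /=; first by apply: P4; lia.
by case: (j =P d :> nat) => jd; [apply: P4'; lia|apply: P3].
Qed.

(** If both [i] and [j] are right descents of [g] (or neither is), then the same
    holds along the two alternating words in [i] and [j], up to length
    [coxm i j]: each letter is a descent (or is not) of the preceding product. *)
Lemma dihedral_rdesc (b : bool) i j g : i != j -> rdesc g i = b -> rdesc g j = b ->
  forall k : nat, (k < coxm i j)%N ->
  rdesc (g * word_val (alt_word i j k))%g (if odd k then j else i) = b /\
  rdesc (g * word_val (alt_word j i k))%g (if odd k then i else j) = b.
Proof.
move=> ij; move: i j ij g.
apply: (coxm_sym_ind (P := fun i j m => forall g, rdesc g i = b -> rdesc g j = b ->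
  forall k : nat, (k < m)%N ->
  rdesc (g * word_val (alt_word i j k))%g (if odd k then j else i) = b /\
  rdesc (g * word_val (alt_word j i k))%g (if odd k then i else j) = b)).
- by move=> i j m h g hj hi k km; have [] := h g hi hj k km.
- move=> i j ij g hi hj; have lj := ltn_ord j.
  case=> [|[|//]] _; rewrite /alt_word /= ?word_val_nil ?mulg1 // !word_val1; split.
  + rewrite -hj; case: (j =P d :> nat) => jd.
      by rewrite !rdesc_last// affmulE sgen_fix//; lia.
    have j0 : j <> 0 :> nat by lia.
    by rewrite !rdesc_mid// !affmulE !sgen_fix//; lia.
  + rewrite -hi; case: (i =P 0 :> nat) => i0.
      by rewrite !rdesc_first// affmulE sgen_fix//; lia.
    have id : i <> d :> nat by lia.
    by rewrite !rdesc_mid// !affmulE !sgen_fix//; lia.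
- move=> i j i0 jd ej g; have lj := ltn_ord j.
  have id : i <> d :> nat by lia.
  have j0 : j <> 0 :> nat by lia.
  have eij : i%:Z + 1 = j%:Z by lia.
  have si1 := sgen_l i0 id; have si2 := sgen_r i0 id.
  have si3 : sgen i (j%:Z + 1) = j%:Z + 1 by apply: sgen_fix; lia.
  have sj1 := sgen_l j0 jd; have sj2 := sgen_r j0 jd.
  have sj3 : sgen j i%:Z = i%:Z by apply: sgen_fix; lia.
  rewrite eij in si1 si2.
  rewrite !rdesc_mid// eij => h1 h2.
  case=> [|[|[|//]]] _; rewrite /alt_word /= ?word_val_cons ?word_val_nil ?mulg1;
   rewrite !rdesc_mid// ?affmulE eij ?(si1, si2, si3, sj1, sj2, sj3);
   by move: h1 h2; clear; case: b; split; lia.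
- move=> i j i0 ej g; have lj := ltn_ord j.
  have j0 : j <> 0 :> nat by lia.
  have jd : j <> d :> nat by lia.
  have ej' : j%:Z = 1%:Z by lia.
  have si1 := sgen_first i0.
  have si2 : sgen i (Posz 2) = Posz 2 by apply: sgen_fix; lia.
  have sj1 := sgen_l j0 jd; have sj2 := sgen_r j0 jd.
  have e2 : 1%:Z + 1 = Posz 2 by [].
  rewrite ej' e2 in sj1 sj2.
  rewrite (rdesc_first _ i0) (rdesc_mid _ j0 jd) ej' e2 => h1 h2.
  case=> [|[|[|[|//]]]] _; rewrite /alt_word /= ?word_val_cons ?word_val_nil ?mulg1;
   rewrite (rdesc_first _ i0) (rdesc_mid _ j0 jd) ?affmulE ej' e2;
   rewrite ?(si1, si2, sj1, sj2, affN);
   by move: h1 h2; clear; case: b; split; lia.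
- move=> i j i0 ej ei g; have lj := ltn_ord j.
  have id : i <> d :> nat by lia.
  have ei' : i%:Z + 1 = d%:Z by lia.
  have sj1 := sgen_last ej.
  have sj2 : sgen j i%:Z = i%:Z by apply: sgen_fix; lia.
  have si1 := sgen_l i0 id; have si2 := sgen_r i0 id.
  rewrite ei' in si1 si2.
  rewrite (rdesc_mid _ i0 id) (rdesc_last _ ej) ei' => h1 h2.
  case=> [|[|[|[|//]]]] _; rewrite /alt_word /= ?word_val_cons ?word_val_nil ?mulg1;
   rewrite (rdesc_mid _ i0 id) (rdesc_last _ ej) ?affmulE ei';
   rewrite ?(si1, si2, sj1, sj2, affN, affMD);
   by move: h1 h2; clear; rewrite /period; case: b; split; lia.
Qed.

Lemma reflection_conj_eq i j x : sgen i x != x ->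
  sgen j (sgen i (sgen j x)) = sgen i x -> (sgen j * sgen i * sgen j)%g = sgen i.
Proof.
move=> hx e; symmetry; apply: (@reflection_eq _ hd _ _ x) => //.
  exact: reflection_sgen.
by apply: reflectionJs => //; apply: reflection_sgen.
Qed.

(** The generators satisfy the braid relations.  Each relation is an equality of
    reflections, checked at one moved point. *)
Lemma braid_affC i j :
  word_val (alt_word i j (coxm i j)) = word_val (alt_word j i (coxm i j)).
Proof.
have [->//|ij] := eqVneq i j; move: i j ij.
apply: (coxm_sym_ind (P := fun i j m =>
  word_val (alt_word i j m) = word_val (alt_word j i m))) => //.
- move=> i j ij; have lj := ltn_ord j.
  rewrite /alt_word /= !word_val_cons word_val_nil !mulg1.
  have : (sgen j * sgen i * sgen j)%g = sgen i.
    case: (i =P 0 :> nat) => i0.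
      have s1 := sgen_first i0.
      have s2 : sgen j 1%:Z = 1%:Z by apply: sgen_fix; lia.
      by apply: (@reflection_conj_eq i j 1%:Z) => //; rewrite ?s2 s1 ?affN ?s2.
    have id : i <> d :> nat by lia.
    have s1 := sgen_l i0 id.
    have s2 : sgen j i%:Z = i%:Z by apply: sgen_fix; lia.
    have s3 : sgen j (i%:Z + 1) = i%:Z + 1 by apply: sgen_fix; lia.
    by apply: (@reflection_conj_eq i j i%:Z) => //; rewrite ?s2 s1 ?s3//; lia.
  by move=> e; rewrite -{1}e mulsK.
- move=> i j i0 jd ej; have lj := ltn_ord j.
  have id : i <> d :> nat by lia.
  have j0 : j <> 0 :> nat by lia.
  have eij : i%:Z + 1 = j%:Z by lia.
  have si1 := sgen_l i0 id; have si2 := sgen_r i0 id.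
  have si3 : sgen i (j%:Z + 1) = j%:Z + 1 by apply: sgen_fix; lia.
  have sj1 := sgen_l j0 jd; have sj2 := sgen_r j0 jd.
  have sj3 : sgen j i%:Z = i%:Z by apply: sgen_fix; lia.
  rewrite eij in si1 si2.
  rewrite /alt_word /= !word_val_cons word_val_nil !mulg1 !mulgA.
  apply: (@reflection_eq _ hd _ _ i%:Z).
  + by apply: reflectionJs => //; apply: reflection_sgen.
  + by apply: reflectionJs => //; apply: reflection_sgen.
  + by rewrite !affmulE si1 sj1 si3; lia.
  + by rewrite !affmulE sj3 si1 sj1 si3.
- move=> i j i0 ej; have lj := ltn_ord j.
  have j0 : j <> 0 :> nat by lia.
  have jd : j <> d :> nat by lia.
  have ej' : j%:Z = 1%:Z by lia.
  have si1 := sgen_first i0.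
  have si2 : sgen i (Posz 2) = Posz 2 by apply: sgen_fix; lia.
  have sj1 := sgen_l j0 jd; have sj2 := sgen_r j0 jd.
  have e2 : 1%:Z + 1 = Posz 2 by [].
  rewrite ej' e2 in sj1 sj2.
  rewrite /alt_word /= !word_val_cons word_val_nil !mulg1 !mulgA.
  set r := (sgen i * sgen j * sgen i)%g.
  suff e : (sgen j * r * sgen j)%g = r by rewrite -{1}e mulsK // /r !mulgA.
  have rr : reflection r by apply: reflectionJs => //; apply: reflection_sgen.
  apply: (@reflection_eq _ hd _ _ 1%:Z) => //; first exact: reflectionJs.
    by rewrite !affmulE sj1 si2 sj2 si1 affN sj1.
  by rewrite !affmulE si1 affN sj1 affN si2 sj2 si1 !affN sj1.
- move=> i j i0 ej ei; have lj := ltn_ord j.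
  have id : i <> d :> nat by lia.
  have ei' : i%:Z + 1 = d%:Z by lia.
  have sj1 := sgen_last ej.
  have sj2 : sgen j i%:Z = i%:Z by apply: sgen_fix; lia.
  have si1 := sgen_l i0 id; have si2 := sgen_r i0 id.
  rewrite ei' in si1 si2.
  rewrite /alt_word /= !word_val_cons word_val_nil !mulg1 !mulgA.
  set r := (sgen j * sgen i * sgen j)%g.
  suff e : (sgen i * r * sgen i)%g = r by rewrite -{1}e mulsK // /r !mulgA.
  have rr : reflection r by apply: reflectionJs => //; apply: reflection_sgen.
  apply: (@reflection_eq _ hd _ _ d%:Z) => //; first exact: reflectionJs.
    by rewrite !affmulE ?(sj1, sj2, si1, si2, affMD, affN) /period; lia.
  by rewrite !affmulE ?(sj1, sj2, si1, si2, affMD, affN).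
Qed.

Lemma alt_wordS i j m :
  alt_word i j m.+1 = rcons (alt_word i j m) (if odd m then j else i).
Proof. by rewrite /alt_word /mkseq -(addn1 m) iotaD map_cat /= cats1. Qed.

Lemma size_alt_word i j m : size (alt_word i j m) = m.
Proof. by rewrite size_mkseq. Qed.

Lemma coxm_gt0 i j : (0 < coxm i j)%N.
Proof. by rewrite /coxm; do 3?case: ifP. Qed.

(** Alternating words of length [coxm i j] are reduced: [dihedral_rdesc] at 1,
    which has no descents. *)
Lemma reduced_alt_word i j : i != j -> reduced (alt_word i j (coxm i j)).
Proof.
move=> ij; suff h m : (m <= coxm i j)%N -> reduced (alt_word i j m) by exact: h.
have r1 (k : 'I_d.+1) : rdesc (1 : W)%g k = false by rewrite /rdesc len1.
elim: m => [|m IH] hm; first by apply/(reducedE hd); rewrite word_val_nil len1.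
rewrite alt_wordS; apply/(reduced_rcons hd); split; first by apply: IH; lia.
have [h _] := dihedral_rdesc ij (r1 i) (r1 j) hm.
by rewrite mul1g in h; rewrite h.
Qed.

(** An element with two right descents factors, with additive lengths, through
    the longest element of the dihedral group that they generate. *)
Lemma dihedral_factor g i j : i != j -> rdesc g i -> rdesc g j ->
  exists u, [/\ reduced (u ++ rev (alt_word i j (coxm i j))),
     reduced (u ++ rev (alt_word j i (coxm i j))),
     word_val (u ++ rev (alt_word i j (coxm i j))) = g &
     word_val (u ++ rev (alt_word j i (coxm i j))) = g].
Proof.
move=> ij hi hj; set m := coxm i j.
have hlen (k : nat) : (k <= m)%N ->
    (len (g * word_val (alt_word i j k))%g + k = len g)%N.
  elim: k => [|k IH] km; first by rewrite word_val_nil mulg1 addn0.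
  rewrite alt_wordS word_val_rcons mulgA -IH; last by lia.
  have [/(rdesc_len hd) -> _] := dihedral_rdesc ij hi hj km.
  by rewrite addSnnS.
set w := (g * word_val (alt_word i j m))%g.
have e1 : word_val (rexpr w ++ rev (alt_word i j m)) = g.
  by rewrite word_val_cat (word_rexpr hd) (word_val_rev hd) /w mulgK.
have e2 : word_val (rexpr w ++ rev (alt_word j i m)) = g.
  by rewrite word_val_cat (word_rexpr hd) (word_val_rev hd) /w braid_affC mulgK.
exists (rexpr w); split=> //; apply/(reducedE hd);
 rewrite (e1, e2) size_cat size_rev size_alt_word;
 by rewrite -(hlen m) // -/(len w).
Qed.

Lemma reduced_size u v : reduced u -> reduced v -> word_val u = word_val v ->
  size u = size v.
Proof. by move=> /(reducedE hd) <- /(reducedE hd) <- ->. Qed.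

Lemma reduced_last_rdesc u i : reduced (rcons u i) -> rdesc (word_val (rcons u i)) i.
Proof. by move=> /(reduced_rcons hd)[_]; rewrite word_val_rcons (rdescS hd). Qed.

(** Matsumoto's theorem: a family satisfying the braid relations has the same
    product along any two reduced expressions of an element. *)
Lemma matsumoto (B : pzRingType) (f : 'I_d.+1 -> B) :
  (forall i j, \prod_(k <- alt_word i j (coxm i j)) f k
             = \prod_(k <- alt_word j i (coxm i j)) f k) ->
  forall u v, reduced u -> reduced v -> word_val u = word_val v ->
  \prod_(k <- u) f k = \prod_(k <- v) f k.
Proof.
move=> braid u; have [n] := ubnP (size u); elim: n u => // n IH u hn v ru rv uv.
have sz := reduced_size ru rv uv.
case/lastP: u hn ru uv sz => [|u i] hn ru uv sz.
  by case: v sz {rv uv}.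
case/lastP: v rv uv sz => [|v j] rv uv sz; first by rewrite size_rcons in sz.
(* words with the same last letter *)
have same (w w' : word) (k : 'I_d.+1) : (size w < n)%N ->
    reduced (rcons w k) -> reduced (rcons w' k) ->
    word_val (rcons w k) = word_val (rcons w' k) ->
    \prod_(l <- rcons w k) f l = \prod_(l <- rcons w' k) f l.
  move=> hw /(reduced_rcons hd)[rw _] /(reduced_rcons hd)[rw' _].
  rewrite !word_val_rcons => /mulIg e.
  by rewrite -!cats1 !big_cat /=; congr (_ * _); apply: IH.
have hun : (size u < n)%N by move: hn; rewrite size_rcons.
have [ij|ij] := eqVneq i j; first by subst j; apply: same.
have hi := reduced_last_rdesc ru; have hj := reduced_last_rdesc rv.
rewrite -uv in hj; have [w [r1 r2 e1 e2]] := dihedral_factor ij hi hj.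
have last_alt (p q : 'I_d.+1) : exists z, rev (alt_word p q (coxm i j)) = rcons z p.
  have := coxm_gt0 i j; case: (coxm i j) => // m _.
  by rewrite /alt_word /mkseq /= rev_cons; eexists.
have br : \prod_(k <- rev (alt_word i j (coxm i j))) f k =
          \prod_(k <- rev (alt_word j i (coxm i j))) f k.
  by rewrite !rev_alt_word; case: ifP => _; rewrite braid.
have [z1 ez1] := last_alt i j; have [z2 ez2] := last_alt j i.
have s1 := reduced_size ru r1 (esym e1).
have s2 := reduced_size rv r2 (etrans (esym uv) (esym e2)).
have hv : (size v < n)%N by move: sz hun; rewrite !size_rcons; lia.
transitivity (\prod_(k <- w ++ rev (alt_word i j (coxm i j))) f k).
  by rewrite ez1 -rcons_cat; apply: same; rewrite // rcons_cat -ez1.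
transitivity (\prod_(k <- w ++ rev (alt_word j i (coxm i j))) f k).
  by rewrite !big_cat br.
rewrite ez2 -rcons_cat; symmetry; apply: same; rewrite // rcons_cat -ez2 //.
by rewrite -uv e2.
Qed.

End Matsumoto.

(** * Bruhat order, parabolic subgroups and double cosets *)

Section Bruhat.
Variable d : nat.
Hypothesis hd : (1 < d)%N.
Local Notation W := (affC d).
Implicit Types (g h w t x y z : W) (i j s : 'I_d.+1).

Lemma bruhat_trans x y z : bruhat_le x y -> bruhat_le y z -> bruhat_le x z.
Proof. by move=> h yz; elim: h yz => // {}x t w rt lt _ IH /IH; apply: bruhat_step. Qed.

Lemma bruhat_edge x t : reflection t -> (len x < len (x * t)%g)%N ->
  bruhat_le x (x * t)%g.
Proof. by move=> rt lt; apply: bruhat_step rt lt (bruhat_refl _). Qed.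

Lemma bruhat_len x y : bruhat_le x y -> (len x <= len y)%N.
Proof. by elim=> // {}x t w _ lt _; apply/leq_trans/ltnW. Qed.

Lemma bruhat_eq x y : bruhat_le x y -> (len y <= len x)%N -> x = y.
Proof. by case=> // {}x t w _ lt /bruhat_len h; lia. Qed.

Lemma reflection_sq t : reflection t -> (t * t = 1)%g.
Proof. by move=> rt; apply: affC_ext => n; rewrite affmulE (reflectionK hd). Qed.

Lemma bruhatV x y : bruhat_le x y -> bruhat_le x^-1%g y^-1%g.
Proof.
elim=> [w|{}x t w rt lt _ IH]; first exact: bruhat_refl.
apply: bruhat_trans IH.
have -> : ((x * t)^-1 = x^-1 * (x * t^-1 * x^-1))%g by rewrite invgM !mulgA mulVg mul1g.
have tV : (t^-1 = t)%g.
  by apply: (mulIg t); rewrite mulVg reflection_sq.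
rewrite tV; apply: bruhat_edge; first exact: reflectionJ.
rewrite (lenV hd) (leq_trans lt)// -(lenV hd (x * t)%g) invgM tV.
by rewrite !mulgA mulVg mul1g.
Qed.

Lemma bruhat_asc x s : ~~ rdesc x s -> bruhat_le x (x * sgen s)%g.
Proof.
move=> h; apply: bruhat_edge; first exact: reflection_sgen.
by rewrite (rasc_len hd h).
Qed.

Lemma bruhat_desc x s : rdesc x s -> bruhat_le (x * sgen s)%g x.
Proof.
by move=> h; have := @bruhat_asc (x * sgen s)%g s; rewrite (rdescS hd) h mulsK //; apply.
Qed.

(** Right multiplication by a generator preserves the elementary steps x < x t of
    the Bruhat order, except the one that it reverses. *)
Lemma edge_mulS x t s : reflection t -> (len x < len (x * t)%g)%N ->
  t = sgen s \/ bruhat_le (x * sgen s)%g (x * t * sgen s)%g.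
Proof.
move=> rt lt; have [->|nt] := pselect (t = sgen s); [by left|right].
have rt' := reflectionJs hd s rt.
have e : (x * t * sgen s = x * sgen s * (sgen s * t * sgen s))%g.
  by rewrite !mulgA mulsK.
rewrite e; apply: bruhat_edge => //.
suff : ~ inverts (x * sgen s)%g (sgen s * t * sgen s)%g.
  rewrite -(inverts_mulr hd _ rt') (len_inverts hd _ rt').
  suff -> : (x * sgen s * (sgen s * t * sgen s) * (sgen s * t * sgen s))%g =
    (x * sgen s)%g by [].
  by rewrite -mulgA reflection_sq // mulg1.
have nt' : (sgen s * t * sgen s)%g <> sgen s.
  move=> e'; apply: nt; have : (sgen s * (sgen s * t * sgen s) * sgen s)%g = sgen s.
    by rewrite e' mulsK.
  by rewrite !mulgA (sgenK hd) mul1g mulsK.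
rewrite (inverts_mulS hd _ rt' nt') !mulgA (sgenK hd) mul1g mulsK //.
by rewrite (len_inverts hd _ rt); lia.
Qed.

(** With x+ the longer of x and x s, and x- the shorter one, y <= x implies
    y s <= x+. *)
Lemma bruhat_mulS_up x y s : bruhat_le y x ->
  bruhat_le (y * sgen s)%g (if rdesc x s then x else (x * sgen s)%g).
Proof.
elim=> [w|{}y t w rt lt hw IH].
  by case: ifP => [/bruhat_desc//|_]; apply: bruhat_refl.
have wup : bruhat_le w (if rdesc w s then w else (w * sgen s)%g).
  by case: ifPn => [_|/bruhat_asc//]; apply: bruhat_refl.
case: (edge_mulS s rt lt) => [e|h]; last exact: bruhat_trans h IH.
by rewrite -{1}e; exact: bruhat_trans hw wup.
Qed.

(** In the same notation, y <= x implies y- <= x-. *)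
Lemma bruhat_mulS_down x y s : bruhat_le y x ->
  bruhat_le (if rdesc y s then (y * sgen s)%g else y)
            (if rdesc x s then (x * sgen s)%g else x).
Proof.
elim=> [w|{}y t w rt lt _ IH]; first exact: bruhat_refl.
apply: bruhat_trans IH.
have hy := bruhat_edge rt lt.
case: (edge_mulS s rt lt) => [->|h].
  by rewrite (rdescS hd); case: (rdesc y s); rewrite ?mulsK //; apply: bruhat_refl.
case: (boolP (rdesc y s)) => hys; case: (boolP (rdesc _ s)) => hts //.
  exact: bruhat_trans (bruhat_desc hys) hy.
exact: bruhat_trans (bruhat_asc hys) h.
Qed.

Lemma bruhat_lift x y s : bruhat_le y x -> ~~ rdesc y s -> bruhat_le y (x * sgen s)%g.
Proof.
move=> yx ys; have [h|h] := boolP (rdesc x s).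
  by have := bruhat_mulS_down s yx; rewrite (negPf ys) h.
exact: bruhat_trans yx (bruhat_asc h).
Qed.

End Bruhat.

Section Parabolic.
Variable d : nat.
Hypothesis hd : (1 < d)%N.
Local Notation W := (affC d).
Local Notation I := 'I_d.+1.
Local Notation word := (seq I).
Implicit Types (g h w t x y z a b : W) (i j s : I) (J K : set I) (u v : word).

(** The parabolic subgroup generated by the simple reflections in [J] *)
Definition Wpar J : set W := gen_subgroup [set sgen k | k in J]%classic.

Lemma Wpar_closed J : group_closed (mem (Wpar J)).
Proof.
split; first by rewrite inE => G [[G1 _] _]; rewrite -[X in X _]/(G) -inE.
move=> x y; rewrite !inE => hx hy G [GG JG]; case: (GG) => _ GD.
have := GD x y; rewrite !inE; apply; [exact: hx|exact: hy].
Qed.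

Lemma Wpar1 J : Wpar J 1%g.
Proof. by have [] := Wpar_closed J; rewrite inE. Qed.

Lemma WparD J x y : Wpar J x -> Wpar J y -> Wpar J (x / y)%g.
Proof. by have [_ /(_ x y)] := Wpar_closed J; rewrite !inE; apply. Qed.

Lemma WparV J x : Wpar J x -> Wpar J x^-1%g.
Proof. by move=> /(WparD (@Wpar1 J)); rewrite div1g. Qed.

Lemma WparM J x y : Wpar J x -> Wpar J y -> Wpar J (x * y)%g.
Proof. by move=> hx /WparV/(WparD hx); rewrite invgK. Qed.

Lemma Wpar_gen J s : J s -> Wpar J (sgen s).
Proof. by move=> Js G [_]; apply; exists s. Qed.

Lemma Wpar_word J u : (forall i, i \in u -> J i) -> Wpar J (word_val u).
Proof.
elim: u => [|i u IH] h; first by rewrite word_val_nil; apply: Wpar1.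
rewrite word_val_cons; apply: WparM; first by apply: Wpar_gen; apply: h; rewrite mem_head.
by apply: IH => j ju; apply: h; rewrite inE ju orbT.
Qed.

(** Elements of a parabolic subgroup have reduced expressions in its generators. *)
Lemma Wpar_reduced J x : Wpar J x ->
  exists u, [/\ forall i, i \in u -> J i, reduced u & word_val u = x].
Proof.
have red u : (forall i, i \in u -> J i) ->
    exists v, [/\ forall i, i \in v -> J i, reduced v & word_val v = word_val u].
  elim/last_ind: u => [|u s IH] h.
    by exists [::]; split=> //; apply/(reducedE hd); rewrite word_val_nil len1.
  have Js : J s by apply: h; rewrite mem_rcons mem_head.
  have [|v [vJ rv ev]] := IH; first by move=> i iu; apply: h; rewrite mem_rcons inE iu orbT.
  have [hs|hs] := boolP (rdesc (word_val v) s); last first.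
    exists (rcons v s); split; last by rewrite !word_val_rcons ev.
      by move=> i; rewrite mem_rcons inE => /orP[/eqP->//|]; apply: vJ.
    exact/(reduced_rcons hd).
  have := (rdescP hd (word_val v) s).1 hs => hinv.
  have [v1 [i [v2 [e e']]]] := strong_exchange hd (reflection_sgen s) hinv.
  exists (v1 ++ v2); split.
  - move=> k; rewrite mem_cat => hk; apply: vJ; rewrite e mem_cat inE.
    by case/orP: hk => ->; rewrite ?orbT.
  - apply/(reducedE hd); rewrite -e'; have := rdesc_len hd hs.
    by have /(reducedE hd) -> := rv; rewrite e !size_cat /=; lia.
  - by rewrite -e' ev word_val_rcons.
move=> hx; have [u [uJ ux]] : exists u, (forall i, i \in u -> J i) /\ word_val u = x.
  apply: (hx [set z | exists u, (forall i, i \in u -> J i) /\ word_val u = z]%classic).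
  split; last first.
    move=> _ [s Js <-]; exists [:: s]; rewrite word_val1; split=> // i.
    by rewrite inE => /eqP->.
  split; first by rewrite inE; exists [::]; rewrite word_val_nil.
  move=> y z; rewrite !inE => -[u [uJ <-]] [v [vJ <-]]; exists (u ++ rev v).
  split; last by rewrite word_val_cat (word_val_rev hd).
  by move=> i; rewrite mem_cat mem_rev => /orP[/uJ|/vJ].
by have [v [? ? ?]] := red u uJ; exists v; split=> //; rewrite -ux.
Qed.

(** Lengths add up on a coset [x W_J] whose element of minimal length is [x]. *)
Lemma min_coset_len J x : (forall a, Wpar J a -> len x <= len (x * a)%g)%N ->
  forall a, Wpar J a -> (len (x * a)%g = len x + len a)%N.
Proof.
move=> hmin a /Wpar_reduced[u [uJ ru <-]]; elim/last_ind: u uJ ru => [|u s IH] uJ ru.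
  by rewrite word_val_nil mulg1 (len1 hd) addn0.
have /(reduced_rcons hd)[ru' hs] := ru.
have uJ' i : i \in u -> J i by move=> iu; apply: uJ; rewrite mem_rcons inE iu orbT.
have {}IH := IH uJ' ru'.
rewrite word_val_rcons (rasc_len hd hs) mulgA addnS -IH; apply: (rasc_len hd).
apply/negP => /(rdescP hd).
rewrite -{1}(word_rexpr hd x) -word_val_cat => hinv.
have [v1 [i [v2 [e e']]]] := strong_exchange hd (reflection_sgen s) hinv.
have Js : J s by apply: uJ; rewrite mem_rcons mem_head.
rewrite word_val_cat (word_rexpr hd) in e'.
have [hv|hv] := ltnP (size v1) (size (rexpr x)).
(* the deleted letter lies in x *)
- have [r er] : exists r, v2 = r ++ u.
    exists (drop (size v1).+1 (rexpr x)).
    have := congr1 (drop (size v1).+1) e; rewrite drop_cat.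
    rewrite -cat_rcons drop_size_cat ?size_rcons //.
    case: ltnP => // h; have eq1 : (size v1).+1 = size (rexpr x) by lia.
    by rewrite eq1 subnn drop0 drop_size.
  have ex : rexpr x = v1 ++ i :: r.
    have sz := congr1 size e; rewrite er !size_cat /= size_cat in sz.
    move: e; rewrite er -cat_cons catA => /eqP; rewrite eqseq_cat; first by case/andP=> /eqP.
    by rewrite size_cat /=; lia.
  have uP : Wpar J (word_val u) by apply: Wpar_word.
  have := hmin _ (WparM (WparM uP (Wpar_gen Js)) (WparV uP)).
  rewrite !mulgA e' er catA word_val_cat mulgK.
  have := len_word hd (v1 ++ r); rewrite {2}/len ex !size_cat /=; lia.
(* the deleted letter lies in the parabolic part *)
- have [r er] : exists r, v1 = rexpr x ++ r.
    exists (drop (size (rexpr x)) v1); rewrite -{1}(cat_take_drop (size (rexpr x)) v1).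
    have := congr1 (take (size (rexpr x))) e; rewrite take_size_cat// take_cat.
    case: ltnP => [_ e0|h e0]; first by rewrite -e0.
    have ez : size (rexpr x) = size v1 by lia.
    by rewrite ez subnn take0 cats0 in e0; rewrite e0 take_size.
  have eu : u = r ++ i :: v2.
    by move: e; rewrite er -catA => /eqP; rewrite eqseq_cat// => /andP[_ /eqP].
  move: e'; rewrite er -catA word_val_cat (word_rexpr hd) -mulgA => /mulgI e'.
  have := rasc_len hd hs; rewrite e'.
  have /(reducedE hd) -> := ru'; have := len_word hd (r ++ v2).
  by rewrite eu !size_cat /=; lia.
Qed.

(** Having no right descent in [J] is enough to be minimal in [x W_J]. *)
Lemma asc_coset_len J x : (forall s, J s -> ~~ rdesc x s) ->
  forall a, Wpar J a -> (len (x * a)%g = len x + len a)%N.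
Proof.
move=> hx; apply: min_coset_len => a Ja.
have [m [Jm hmin]] : exists m, Wpar J m /\
    forall b, Wpar J b -> (len (x * m)%g <= len (x * b)%g)%N.
  have [n] := ubnP (len (x * a)%g); elim: n a Ja => // n IH a Ja hn.
  have [[b [Jb hb]]|no] := pselect (exists b, Wpar J b /\ (len (x * b) < len (x * a))%g%N).
    by apply: (IH b) => //; lia.
  exists a; split=> // b Jb; rewrite leqNgt; apply/negP => hb.
  by apply: no; exists b.
have hadd : forall b, Wpar J b -> (len (x * m * b)%g = len (x * m)%g + len b)%N.
  by apply: min_coset_len => b Jb; rewrite -mulgA; apply: hmin; apply: WparM.
suff -> : x = (x * m)%g by rewrite -mulgA; apply: hmin; apply: WparM.
have := Wpar_reduced (WparV Jm) => -[u].
case/lastP: u => [|u s] [uJ ru eu].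
  by rewrite word_val_nil in eu; rewrite -(invgK m) -eu invg1 mulg1.
have Js : J s by apply: uJ; rewrite mem_rcons mem_head.
have /(reduced_rcons hd)[_ hs] := ru.
have h1 : len x = (len (x * m)%g + len m^-1%g)%N.
  by rewrite -hadd ?mulgK//; apply: WparV.
have h2 : len (x * sgen s)%g = (len (x * m)%g + len (m^-1 * sgen s)%g)%N.
  by rewrite -hadd ?mulgA ?mulgK//; apply: WparM; [apply: WparV|apply: Wpar_gen].
have := rasc_len hd (hx s Js); rewrite h1 h2 -eu word_val_rcons mulsK // (rasc_len hd hs); lia.
Qed.

(** The double coset [W_J w W_K] *)
Definition dc J K w : set W := [set (a * w * b)%g | a in Wpar J & b in Wpar K]%classic.

(** The distinguished double coset representatives: lengths add up under
    multiplication by [W_J] on the left and by [W_K] on the right. *)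
Definition dmin J K w : Prop :=
  (forall a, Wpar J a -> len (a * w)%g = (len a + len w)%N) /\
  (forall a, Wpar K a -> len (a * w^-1)%g = (len a + len w^-1%g)%N).

Lemma dc_refl J K w : dc J K w w.
Proof. by exists 1%g; [exact: Wpar1|exists 1%g; [exact: Wpar1|rewrite mul1g mulg1]]. Qed.

Lemma dc_sym J K w (v : W) : dc J K w v -> dc J K v w.
Proof.
move=> [a Ja [b Kb <-]]; exists a^-1%g; first exact: WparV.
by exists b^-1%g; [exact: WparV|rewrite !mulgA mulVg mul1g mulgK].
Qed.

Lemma dc_trans J K w (v z : W) : dc J K w v -> dc J K v z -> dc J K w z.
Proof.
move=> [a Ja [b Kb <-]] [a' Ja' [b' Kb' <-]]; exists (a' * a)%g; first exact: WparM.
by exists (b * b')%g; [exact: WparM|rewrite !mulgA].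
Qed.

Lemma dc_l J K w s : J s -> dc J K w (sgen s * w)%g.
Proof.
move=> Js; exists (sgen s); first exact: Wpar_gen.
by exists 1%g; [exact: Wpar1|rewrite mulg1].
Qed.

Lemma dc_r J K w s : K s -> dc J K w (w * sgen s)%g.
Proof.
move=> Ks; exists 1%g; first exact: Wpar1.
by exists (sgen s); [exact: Wpar_gen|rewrite mul1g].
Qed.

(** A double coset is reached from any of its elements by multiplications by
    generators. *)
Lemma dc_ind J K w (P : W -> Prop) : P w ->
  (forall (v : W) s, J s -> P v -> P (sgen s * v)%g) ->
  (forall (v : W) s, K s -> P v -> P (v * sgen s)%g) -> forall v : W, dc J K w v -> P v.
Proof.
move=> Pw Pl Pr v [a /Wpar_reduced[u [uJ _ <-]] [b /Wpar_reduced[u' [uK _ <-]] <-]].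
have {uJ}Pa : P (word_val u * w)%g.
  elim: u uJ => [|s u IH] uJ; first by rewrite word_val_nil mul1g.
  rewrite word_val_cons -mulgA; apply: Pl; first by apply: uJ; rewrite mem_head.
  by apply: IH => i iu; apply: uJ; rewrite inE iu orbT.
elim/last_ind: u' uK => [|u' s IH] uK; first by rewrite word_val_nil mulg1.
rewrite word_val_rcons mulgA; apply: Pr; first by apply: uK; rewrite mem_rcons mem_head.
by apply: IH => i iu; apply: uK; rewrite mem_rcons inE iu orbT.
Qed.

Lemma dmin_asc_r J K w s : dmin J K w -> K s -> ~~ rdesc w s.
Proof.
move=> [_ h] Ks; rewrite /rdesc -leqNgt -(lenV hd (w * _)%g) invgM (sgenV hd).
by rewrite h ?(lenV hd) ?leq_addl //; apply: Wpar_gen.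
Qed.

Lemma dmin_asc_l J K w s : dmin J K w -> J s -> ~~ rdesc w^-1%g s.
Proof.
move=> [h _] Js; rewrite /rdesc -leqNgt -(lenV hd (_ * sgen _)%g) invgM invgK (sgenV hd).
by rewrite h ?(lenV hd) ?leq_addl //; apply: Wpar_gen.
Qed.

Lemma dmin_exists J K w : exists y, dmin J K y /\ dc J K w y.
Proof.
have [y [hy hmin]] : exists y, dc J K w y /\ forall v : W, dc J K w v -> (len y <= len v)%N.
  have : dc J K w w by apply: dc_refl.
  move: {2}w => z; have [n] := ubnP (len z); elim: n z => // n IH z hn hv.
  have [[b [Jb hb]]|no] := pselect (exists b, dc J K w b /\ (len b < len z)%N).
    by apply: (IH b) => //; lia.
  exists z; split=> // b Jb; rewrite leqNgt; apply/negP => hb.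
  by apply: no; exists b.
exists y; split=> //; split=> a ha.
- rewrite -(lenV hd (a * y)%g) invgM addnC.
  rewrite (@asc_coset_len J) ?(lenV hd) //; last exact: WparV.
  move=> s Js; rewrite /rdesc -leqNgt -(lenV hd (_ * sgen _)%g).
  rewrite invgM invgK (sgenV hd) (lenV hd).
  by apply: hmin; apply: dc_trans hy (dc_l _ _ Js).
- rewrite -(lenV hd (a * _)%g) invgM invgK addnC.
  rewrite (@asc_coset_len K) ?(lenV hd) //; last exact: WparV.
  by move=> s Ks; rewrite /rdesc -leqNgt; apply: hmin; apply: dc_trans hy (dc_r _ _ Ks).
Qed.

(** A minimal element below one element of a double coset is below all of them. *)
Lemma dmin_bruhat J K y w (v : W) : dmin J K y -> bruhat_le y w -> dc J K w v ->
  bruhat_le y v.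
Proof.
move=> hy yw; apply: dc_ind => // {}v s Js yv.
  have := bruhat_lift hd (bruhatV hd yv) (dmin_asc_l hy Js).
  by move=> /(bruhatV hd); rewrite invgK invgM invgK (sgenV hd).
have ys := dmin_asc_r hy Js.
exact: (bruhat_lift hd yv ys).
Qed.

End Parabolic.

(** * The standard basis of the Hecke algebra *)

Section HeckeBasis.
Variable d : nat.
Hypothesis hd : (1 < d)%N.
Local Notation W := (affC d).
Local Notation A := laurent.
Local Notation I := 'I_d.+1.
Local Notation word := (seq I).
Implicit Types (g w v : W) (i j s t : I) (u : word) (f : W -> A) (a b : A).

(** Stated for [affC], so that the products that it introduces are syntactically
    those of the other statements. *)
Lemma affA (x y z : W) : (x * (y * z) = x * y * z)%g.
Proof. exact: mulgA. Qed.

(** The generator [i] is a left descent of [w]. *)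
Definition ldesc w i : bool := (len (sgen i * w)%g < len w)%N.

Lemma ldescE w i : ldesc w i = rdesc w^-1%g i.
Proof. by rewrite /ldesc /rdesc -(lenV hd (_ * w)%g) invgM (sgenV hd) (lenV hd w). Qed.

Lemma ldescS w i : ldesc (sgen i * w)%g i = ~~ ldesc w i.
Proof. by rewrite !ldescE invgM (sgenV hd) (rdescS hd). Qed.

Lemma lasc_len w i : ~~ ldesc w i -> len (sgen i * w)%g = (len w).+1.
Proof.
rewrite ldescE => /(rasc_len hd).
by rewrite -[in LHS](sgenV hd) -invgM !(lenV hd).
Qed.

Lemma ldesc_len w i : ldesc w i -> len w = (len (sgen i * w)%g).+1.
Proof.
rewrite ldescE => /(rdesc_len hd).
by rewrite -[in X in _ = X.+1](sgenV hd) -invgM !(lenV hd).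
Qed.

Lemma ldesc1 i : ldesc (1 : W)%g i = false.
Proof. by rewrite /ldesc (len1 hd). Qed.

Lemma rdesc1 i : rdesc (1 : W)%g i = false.
Proof. by rewrite /rdesc (len1 hd). Qed.

Lemma reduced_cons i u : reduced (i :: u) <-> reduced u /\ ~~ ldesc (word_val u) i.
Proof.
rewrite !(reducedE hd) word_val_cons /=; have := len_word hd u.
have [h|h] := boolP (ldesc (word_val u) i).
  by have := ldesc_len h; split; lia.
by have := lasc_len h; split; lia.
Qed.

Lemma reduced_rexpr w : reduced (rexpr w). Proof. by case: (rexprP hd w). Qed.

(** If right multiplication by a generator changes whether [s] is a left
    descent, then it agrees with left multiplication by [s]. *)
Lemma ldesc_mulS w s t : ldesc (w * sgen t)%g s <> ldesc w s ->
  (sgen s * w = w * sgen t)%g.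
Proof.
wlog hs : w / ~~ ldesc w s => [hw|].
  have [h|h] := boolP (ldesc w s); last by move=> h'; apply: hw => //; rewrite (negPf h).
  move=> h'; have := hw (w * sgen t)%g; rewrite mulsK //.
  case: (ldesc _ s) h' => // _ e.
  have {}e : (sgen s * (w * sgen t))%g = w by apply: e => //; rewrite h.
  by rewrite -[in RHS]e !mulgA mulsK.
rewrite (negPf hs) => /eqP; rewrite eqbF_neg negbK => ht.
have l1 := lasc_len hs; have l2 := ldesc_len ht.
have l3 := len_mulS hd w t; have l4 := len_mulS hd (sgen s * w)%g t.
have ew : (sgen s * w * sgen t)%g = (sgen s * (w * sgen t))%g by rewrite mulgA.
rewrite ew in l4.
have hr : rdesc (sgen s * w)%g t.
  by rewrite /rdesc ew; move: l3; case: (rdesc w t); lia.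
have := (rdescP hd _ _).1 hr; rewrite -{1}(word_rexpr hd w) -word_val_cons => hinv.
have [[|i v1] [j [v2 [e e']]]] := strong_exchange hd (reflection_sgen t) hinv.
  case: e e' => _ e /=; rewrite word_val_cons -e (word_rexpr hd) => e'.
  by rewrite -{2}e' mulsK.
case: e e' => <- e /=; rewrite !word_val_cons (word_rexpr hd) ew => /mulgI e'.
have := len_word hd (v1 ++ v2); rewrite -e'.
have : len w = (size (v1 ++ v2)).+1 by rewrite /len e !size_cat /=; lia.
by move: l3 l4; rewrite hr; case: (rdesc w t); lia.
Qed.

Lemma rdesc_mulS w s t : rdesc (sgen s * w)%g t <> rdesc w t ->
  (sgen s * w = w * sgen t)%g.
Proof.
have := @ldesc_mulS w^-1%g t s; rewrite !ldescE invgM !invgK (sgenV hd) => h /h e.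
by apply: (can_inj invgK); rewrite !invgM (sgenV hd) (sgenV hd).
Qed.

(** Scalars that agree on the inner generators satisfy the braid relations, the
    other relations having even length. *)
Lemma scalar_braid (c : I -> A) :
  (forall i j, i <> 0 :> nat -> i <> d :> nat ->
     j <> 0 :> nat -> j <> d :> nat -> c i = c j) ->
  forall i j, \prod_(k <- alt_word i j (coxm i j)) c k
            = \prod_(k <- alt_word j i (coxm i j)) c k.
Proof.
move=> hc i j; have [->//|ij] := eqVneq i j; move: i j ij.
apply: (coxm_sym_ind hd (P := fun i j m => \prod_(k <- alt_word i j m) c k
            = \prod_(k <- alt_word j i m) c k)) => //.
- by move=> i j _; rewrite /alt_word /= !big_cons !big_nil; ring.
- move=> i j i0 jd e; have lj := ltn_ord j.
  by rewrite /alt_word /= !big_cons !big_nil (hc i j) //; lia.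
- by move=> i j _ _; rewrite /alt_word /= !big_cons !big_nil; ring.
- by move=> i j _ _ _; rewrite /alt_word /= !big_cons !big_nil; ring.
Qed.

Lemma qs_braid i j : \prod_(k <- alt_word i j (coxm i j)) qs k
                   = \prod_(k <- alt_word j i (coxm i j)) qs k.
Proof.
apply: scalar_braid => {}i {}j /eqP/negPf i0 /eqP/negPf id /eqP/negPf j0 /eqP/negPf jd.
by rewrite /qs i0 id j0 jd.
Qed.

Lemma qpar_braid i j : \prod_(k <- alt_word i j (coxm i j)) qpar k
                     = \prod_(k <- alt_word j i (coxm i j)) qpar k.
Proof.
apply: scalar_braid => {}i {}j /eqP/negPf i0 /eqP/negPf id /eqP/negPf j0 /eqP/negPf jd.
by rewrite /qpar i0 id j0 jd.
Qed.

Lemma prod_unit (c : I -> A) u : (forall i, c i \is a GRing.unit) ->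
  \prod_(k <- u) c k \is a GRing.unit.
Proof.
move=> h; elim: u => [|i u IH]; first by rewrite big_nil unitr1.
by rewrite big_cons unitrM h IH.
Qed.

(** Generators that are conjugate by [w] as below have equal parameters. *)
Lemma conj_scalar (c : I -> A) w s t : (forall i, c i \is a GRing.unit) ->
  (forall i j, \prod_(k <- alt_word i j (coxm i j)) c k
             = \prod_(k <- alt_word j i (coxm i j)) c k) ->
  (sgen s * w = w * sgen t)%g -> c s = c t.
Proof.
move=> cu cb; wlog hs : w / ~~ ldesc w s => [hw e|e].
  have [h|h] := boolP (ldesc w s); last exact: hw e.
  apply: (hw (sgen s * w)%g); first by rewrite ldescS h.
  by rewrite mulKs // e mulsK.
have r1 : reduced (s :: rexpr w).
  by apply/reduced_cons; rewrite (word_rexpr hd); split=> //; apply: reduced_rexpr.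
have r2 : reduced (rcons (rexpr w) t).
  apply/(reducedE hd); rewrite word_val_rcons (word_rexpr hd) -e size_rcons.
  by rewrite (lasc_len hs).
have := matsumoto hd cb r1 r2.
rewrite word_val_cons word_val_rcons (word_rexpr hd) e => /(_ erefl).
rewrite big_cons -cats1 big_cat big_seq1 /= mulrC.
by apply: mulrI; apply: (prod_unit _ cu).
Qed.

(** The constant term in T_i^2 = (qpar i - qs i) T_i + qpar i * qs i *)
Definition qq i : A := qpar i * qs i.

(** The regular representations.  A function [f] on W stands for the formal,
    possibly infinite, sum of the [f w] T_w; [lop i] and [rop i] are the
    multiplications by T_i on the left and on the right. *)
Definition lop i f : W -> A := fun w =>
  if ldesc w i then f (sgen i * w)%g + (qpar i - qs i) * f w
  else qq i * f (sgen i * w)%g.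
Definition rop i f : W -> A := fun w =>
  if rdesc w i then f (w * sgen i)%g + (qpar i - qs i) * f w
  else qq i * f (w * sgen i)%g.

Lemma qq_unit i : qq i \is a GRing.unit.
Proof. by rewrite unitrM qpar_unit qs_unit. Qed.

(** The left and right operators commute.  The only delicate case is s w = w t,
    where [s] and [t] have the same parameters. *)
Lemma lop_rop s t f : lop s (rop t f) = rop t (lop s f).
Proof.
apply/funext => w; rewrite /lop /rop; set a := sgen s; set b := sgen t.
have [e|ne] := pselect (a * w = w * b)%g.
- have l1 : ldesc (w * b)%g s = ~~ ldesc w s by rewrite -e ldescS.
  have l2 : rdesc (a * w)%g t = ~~ rdesc w t by rewrite e (rdescS hd).
  have l3 : ldesc w s = rdesc w t by rewrite /ldesc /rdesc -/a -/b e.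
  have e1 : (a * w * b)%g = w by rewrite e mulsK.
  have e2 : (a * (w * b))%g = w by rewrite mulgA.
  have <- : qpar s = qpar t.
    by apply: (conj_scalar (w := w)) => //; [exact: qpar_unit|exact: qpar_braid].
  have <- : qs s = qs t.
    by apply: (conj_scalar (w := w)) => //; [exact: qs_unit|exact: qs_braid].
  have -> : qq t = qq s.
    apply: esym; apply: (conj_scalar (w := w)) => // [i|i j]; first exact: qq_unit.
    by rewrite !big_split /= qs_braid qpar_braid.
  rewrite l1 l2 e1 e2 l3 e; case: (rdesc w t) => /=; ring.
- have l1 : ldesc (w * b)%g s = ldesc w s.
    by have [//|h] := pselect (ldesc (w * b)%g s = ldesc w s); case: ne; apply: ldesc_mulS.
  have l2 : rdesc (a * w)%g t = rdesc w t.
    by have [//|h] := pselect (rdesc (a * w)%g t = rdesc w t); case: ne; apply: rdesc_mulS.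
  rewrite l1 l2 !mulgA; case: (ldesc w s); case: (rdesc w t); ring.
Qed.

Lemma lop_quad i f w :
  lop i (lop i f) w = (qpar i - qs i) * lop i f w + qq i * f w.
Proof.
rewrite /lop ldescS mulKs //; case: (ldesc w i) => /=; ring.
Qed.

(** The operators attached to words *)
Definition lops u f : W -> A := foldr lop f u.
Definition rops u f : W -> A := foldr rop f u.

Lemma lop_rops s u f : lop s (rops u f) = rops u (lop s f).
Proof. by elim: u => //= i u IH; rewrite lop_rop IH. Qed.

Lemma lops_rops (v : word) u f : lops v (rops u f) = rops u (lops v f).
Proof. by elim: v => //= i v IH; rewrite IH lop_rops. Qed.

Lemma lops_ext u f w : len (word_val (rev u) * w)%g = (size u + len w)%N ->
  lops u f w = (\prod_(k <- u) qq k) * f (word_val (rev u) * w)%g.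
Proof.
elim: u w => [|i u IH] w; first by rewrite /= big_nil word_val_nil mul1r mul1g.
rewrite rev_cons word_val_rcons -affA /= big_cons => h.
have hl : ~~ ldesc w i.
  apply/negP => /ldesc_len h1.
  have := lenM hd (word_val (rev u)) (sgen i * w)%g; have := len_word hd (rev u).
  by rewrite size_rev; lia.
rewrite {1}/lop (negPf hl) IH ?mulrA // h (lasc_len hl); lia.
Qed.

Lemma rops_ext u f w : len (w * word_val u)%g = (len w + size u)%N ->
  rops u f w = (\prod_(k <- u) qq k) * f (w * word_val u)%g.
Proof.
elim: u w => [|i u IH] w; first by rewrite /= big_nil word_val_nil mul1r mulg1.
rewrite word_val_cons affA /= big_cons => h.
have hl : ~~ rdesc w i.
  apply/negP => /(rdesc_len hd) h1.
  by have := lenM hd (w * sgen i)%g (word_val u); have := len_word hd u; lia.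
rewrite {1}/rop (negPf hl) IH ?mulrA // h (rasc_len hd hl); lia.
Qed.

(** The value at [w] is, up to a unit, the value at 1 after applying the right
    operators of a reduced word of [w]; this reduces the braid relations of the
    [lop i] to those of the group and of the scalars. *)
Lemma lops_braid i j f :
  lops (alt_word i j (coxm i j)) f = lops (alt_word j i (coxm i j)) f.
Proof.
have [->//|ij] := eqVneq i j; apply/funext => w.
have pu : \prod_(k <- rexpr w) qq k \is a GRing.unit by apply: prod_unit; apply: qq_unit.
apply: (mulrI pu).
have ev F : (\prod_(k <- rexpr w) qq k) * F w = rops (rexpr w) F 1%g.
  by rewrite rops_ext mul1g (word_rexpr hd) // (len1 hd).
rewrite !ev -!lops_rops.
have rv (p q : I) : p != q -> len (word_val (rev (alt_word p q (coxm p q))) * 1)%g =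
    (size (alt_word p q (coxm p q)) + len (1 : W)%g)%N.
  move=> pq; rewrite mulg1 (word_val_rev hd) (lenV hd) (len1 hd) addn0.
  exact/(reducedE hd)/(reduced_alt_word hd).
rewrite lops_ext ?rv // lops_ext; last by rewrite coxmC rv // eq_sym.
by rewrite !big_split /= qs_braid qpar_braid !(word_val_rev hd) (braid_affC hd).
Qed.

(** The action of formal expressions on functions, compatible by [act_heq] with
    the relations of the Hecke algebra *)
Fixpoint act (e : hexp d) f : W -> A :=
  match e with
  | hcst a => fun w => a * f w
  | hgen i => lop i f
  | hadd x y => fun w => act x f w + act y f w
  | hmul x y => act x (act y f)
  end.

Lemma act_add e f f' : act e (fun w => f w + f' w) = (fun w => act e f w + act e f' w).
Proof.
elim: e f f' => [a|i|x IHx y IHy|x IHx y IHy] f f' /=.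
- by apply/funext => w; rewrite mulrDr.
- by apply/funext => w; rewrite /lop; case: ifP => _; ring.
- by apply/funext => w; rewrite IHx IHy addrACA.
- by rewrite IHy IHx.
Qed.

Lemma act_scale e a f : act e (fun w => a * f w) = (fun w => a * act e f w).
Proof.
elim: e f => [b|i|x IHx y IHy|x IHx y IHy] f /=.
- by apply/funext => w; rewrite mulrCA.
- by apply/funext => w; rewrite /lop; case: ifP => _; ring.
- by apply/funext => w; rewrite IHx IHy mulrDr.
- by rewrite IHy IHx.
Qed.

Lemma act_rop e i f : act e (rop i f) = rop i (act e f).
Proof.
elim: e f => [b|j|x IHx y IHy|x IHx y IHy] f /=.
- by apply/funext => w; rewrite /rop; case: ifP => _; ring.
- exact: lop_rop.
- by apply/funext => w; rewrite IHx IHy /rop; case: ifP => _; ring.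
- by rewrite IHy IHx.
Qed.

Lemma act_word u f : act (hword u) f = lops u f.
Proof.
elim: u => [|i u /= ->] //=; by apply/funext => w; rewrite mul1r.
Qed.

Lemma act_heq e e' : heq e e' -> act e = act e'.
Proof.
elim=> {e e'} //=.
- by move=> x y z _ -> _ ->.
- by move=> x x' y y' _ -> _ ->.
- by move=> x x' y y' _ -> _ ->.
- by move=> x y z; apply/funext => f; apply/funext => w; rewrite addrA.
- by move=> x y; apply/funext => f; apply/funext => w; rewrite addrC.
- by move=> x; apply/funext => f; apply/funext => w; rewrite mul0r add0r.
- by move=> x; apply/funext => f; apply/funext => w; rewrite mulN1r addNr mul0r.
- by move=> x; apply/funext => f; apply/funext => w; rewrite mul1r.
- move=> x; apply/funext => f; congr (act x _); by apply/funext => w; rewrite mul1r.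
- by move=> x y z; apply/funext => f; rewrite act_add.
- by move=> a b; apply/funext => f; apply/funext => w; rewrite mulrDl.
- by move=> a b; apply/funext => f; apply/funext => w; rewrite mulrA.
- by move=> a x; apply/funext => f; rewrite act_scale.
- move=> i; apply/funext => f; apply/funext => w.
  have -> : lop i (fun v => lop i f v + qs i * f v) =
            (fun v => lop i (lop i f) v + qs i * lop i f v).
    by move: {1 2}(lop i f) => f'; apply/funext => v; rewrite /lop; case: ifP => _; ring.
  by rewrite lop_quad /qq; ring.
- by move=> i j; apply/funext => f; rewrite !act_word lops_braid.
Qed.

(** The function that stands for T_v *)
Definition delta v : W -> A := fun w => (w == v)%:R.

(** The coefficients of an element of the Hecke algebra on the T_w: its action on
    the function that stands for T_1 *)
Definition tcoef (x : hecke d) : W -> A := act (hrep x) (delta 1%g).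

Lemma tcoef_class e : tcoef (hclass e) = act e (delta 1%g).
Proof. by rewrite /tcoef (act_heq (hrep_class e)). Qed.

Lemma tcoefD (x y : hecke d) w : tcoef (x + y) w = tcoef x w + tcoef y w.
Proof.
rewrite -(hrepK x) -(hrepK y); have -> : hclass (hrep x) + hclass (hrep y) =
  hclass (hadd (hrep x) (hrep y)) by exact: hk_addE.
by rewrite !tcoef_class.
Qed.

Lemma tcoefZ a (x : hecke d) w : tcoef (a *: x) w = a * tcoef x w.
Proof.
rewrite -(hrepK x); have -> : a *: hclass (hrep x) = hclass (hmul (hcst d a) (hrep x)).
  exact: hk_mulE.
by rewrite !tcoef_class.
Qed.

Lemma tcoef0 w : tcoef 0 w = 0.
Proof. by rewrite -(scale0r (0 : hecke d)) tcoefZ mul0r. Qed.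

Lemma tcoefB (x y : hecke d) w : tcoef (x - y) w = tcoef x w - tcoef y w.
Proof. by rewrite -scaleN1r tcoefD tcoefZ mulN1r. Qed.

Lemma tcoef_sum (T : Type) (r : seq T) (F : T -> hecke d) w :
  tcoef (\sum_(k <- r) F k) w = \sum_(k <- r) tcoef (F k) w.
Proof. exact: (big_morph (tcoef^~ w) (fun x y => tcoefD x y w) (tcoef0 w)). Qed.

Lemma tcoef_lT i x : tcoef (hT i * x) = lop i (tcoef x).
Proof.
rewrite -{1}(hrepK x); have -> : hT i * hclass (hrep x) = hclass (hmul (hgen i) (hrep x)).
  exact: hk_mulE.
by rewrite tcoef_class.
Qed.

Lemma lop_delta i v : ~~ ldesc v i -> lop i (delta v) = delta (sgen i * v)%g.
Proof.
move=> hv; apply/funext => w; rewrite /lop /delta.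
have -> : (sgen i * w == v)%g = (w == sgen i * v)%g.
  by apply/eqP/eqP => [<-|->]; rewrite mulKs.
case: (boolP (ldesc w i)) => hw.
  have -> : (w == v) = false by apply: contraTF hw => /eqP->.
  by rewrite mulr0 addr0.
have -> : (w == sgen i * v)%g = false; last by rewrite mulr0.
by apply: contraNF hw => /eqP->; rewrite ldescS.
Qed.

Lemma rop_delta i v : ~~ rdesc v i -> rop i (delta v) = delta (v * sgen i)%g.
Proof.
move=> hv; apply/funext => w; rewrite /rop /delta.
have -> : (w * sgen i == v)%g = (w == v * sgen i)%g.
  by apply/eqP/eqP => [<-|->]; rewrite mulsK.
case: (boolP (rdesc w i)) => hw.
  have -> : (w == v) = false by apply: contraTF hw => /eqP->.
  by rewrite mulr0 addr0.
have -> : (w == v * sgen i)%g = false; last by rewrite mulr0.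
by apply: contraNF hw => /eqP->; rewrite (rdescS hd).
Qed.

Lemma tcoef_rT i x : tcoef (x * hT i) = rop i (tcoef x).
Proof.
rewrite -{1}(hrepK x); have -> : hclass (hrep x) * hT i = hclass (hmul (hrep x) (hgen i)).
  exact: hk_mulE.
rewrite tcoef_class /= lop_delta ?ldesc1 // mulg1.
have -> : delta (sgen i) = rop i (delta 1%g) by rewrite rop_delta ?rdesc1 // mul1g.
by rewrite act_rop.
Qed.

Lemma tcoef1 : tcoef 1 = delta 1%g.
Proof.
have -> : (1 : hecke d) = hclass (hcst d 1) by [].
by rewrite tcoef_class; apply/funext => w /=; rewrite mul1r.
Qed.

Lemma tcoef_word u : reduced u -> tcoef (hTword u) = delta (word_val u).
Proof.
elim: u => [|i u IH]; first by rewrite /hTword big_nil word_val_nil tcoef1.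
move=> /reduced_cons[ru hu].
by rewrite /hTword big_cons tcoef_lT IH // lop_delta // word_val_cons.
Qed.

Lemma tcoef_TW v : tcoef (hTW v) = delta v.
Proof. by rewrite tcoef_word ?(word_rexpr hd) //; apply: reduced_rexpr. Qed.

Lemma hTW_word u : reduced u -> hTword u = hTW (word_val u).
Proof.
move=> ru; apply: (matsumoto hd) => //; [|exact: reduced_rexpr|by rewrite (word_rexpr hd)].
exact: (@hT_relations d).2.
Qed.

Lemma hT_asc i w : ~~ ldesc w i -> hT i * hTW w = hTW (sgen i * w)%g.
Proof.
move=> h; have r : reduced (i :: rexpr w).
  by apply/reduced_cons; rewrite (word_rexpr hd); split=> //; apply: reduced_rexpr.
by have := hTW_word r; rewrite word_val_cons (word_rexpr hd) /hTword big_cons.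
Qed.

Lemma hT_desc i w : ldesc w i ->
  hT i * hTW w = (qpar i - qs i) *: hTW w + qq i *: hTW (sgen i * w)%g.
Proof.
move=> h; have h' : ~~ ldesc (sgen i * w)%g i by rewrite ldescS h.
have := hT_asc h'; rewrite mulKs // => <-.
by rewrite mulrA hTsq mulrDl mulr_algl scalerAl.
Qed.

Lemma hecke_span (x : hecke d) :
  exists l : seq (A * W), x = \sum_(p <- l) p.1 *: hTW p.2.
Proof.
have add (y z : hecke d) : (exists l : seq (A * W), y = \sum_(p <- l) p.1 *: hTW p.2) ->
    (exists l : seq (A * W), z = \sum_(p <- l) p.1 *: hTW p.2) ->
    exists l : seq (A * W), y + z = \sum_(p <- l) p.1 *: hTW p.2.
  by move=> [l ->] [l' ->]; exists (l ++ l'); rewrite big_cat.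
have scal a (y : hecke d) : (exists l : seq (A * W), y = \sum_(p <- l) p.1 *: hTW p.2) ->
    exists l : seq (A * W), a *: y = \sum_(p <- l) p.1 *: hTW p.2.
  move=> [l ->]; exists [seq (a * p.1, p.2) | p <- l].
  by rewrite big_map scaler_sumr; apply: eq_bigr => p _; rewrite scalerA.
have one w : exists l : seq (A * W), hTW w = \sum_(p <- l) p.1 *: hTW p.2.
  by exists [:: (1, w)]; rewrite big_seq1 scale1r.
suff h (y : hecke d) : (exists l : seq (A * W), y = \sum_(p <- l) p.1 *: hTW p.2) ->
    exists l : seq (A * W), x * y = \sum_(p <- l) p.1 *: hTW p.2.
  rewrite -(mulr1 x); apply: h.
  suff -> : (1 : hecke d) = hTW 1%g by apply: one.
  rewrite -word_val_nil -hTW_word; first by rewrite /hTword big_nil.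
  by apply/(reducedE hd); rewrite word_val_nil (len1 hd).
elim/hecke_ind: x y => [a|i|x x' IH IH'|x x' IH IH'] y hy.
- by rewrite mulr_algl; apply: (@scal).
- case: hy => l ->; rewrite mulr_sumr; elim: l => [|p l IH].
    by exists [::]; rewrite !big_nil.
  rewrite big_cons; apply: (@add) => //; rewrite -scalerAr; apply: (@scal).
  case: (boolP (ldesc p.2 i)) => h; last by rewrite hT_asc.
  by rewrite hT_desc //; apply: (@add); apply: (@scal); apply: one.
- by rewrite mulrDl; apply: (@add); [apply: IH|apply: IH'].
- by rewrite -mulrA; apply/IH/IH'.
Qed.

(** With [tcoef_TW], this says that the T_w form a basis. *)
Lemma hecke_coef (x : hecke d) :
  exists S : seq W, x = \sum_(w <- S) tcoef x w *: hTW w.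
Proof.
have [l e] := hecke_span x; exists (undup [seq p.2 | p <- l]).
have cx w : tcoef x w = \sum_(p <- l) p.1 * (w == p.2)%:R.
  by rewrite e tcoef_sum; apply: eq_bigr => p _; rewrite tcoefZ tcoef_TW.
rewrite {1}e.
transitivity (\sum_(w <- undup [seq p.2 | p <- l])
   \sum_(p <- l) (p.1 * (w == p.2)%:R) *: hTW w); last first.
  by apply: eq_bigr => w _; rewrite cx scaler_suml.
rewrite exchange_big /= big_seq [RHS]big_seq; apply: eq_bigr => p pl.
rewrite (bigD1_seq p.2) ?undup_uniq ?mem_undup ?map_f //= eqxx mulr1.
by rewrite big1 ?addr0 // => w /negPf ->; rewrite mulr0 scale0r.
Qed.

Lemma tcoef_inj x y : tcoef x =1 tcoef y -> x = y.
Proof.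
move=> h; apply/eqP; rewrite -subr_eq0; have [S ->] := hecke_coef (x - y).
by rewrite big1 // => w _; rewrite tcoefB h subrr scale0r.
Qed.

Lemma tcoef_support x : exists S : seq W, forall w, tcoef x w != 0 -> w \in S.
Proof.
have [S e] := hecke_coef x; exists S => w; apply: contraNT => wS.
rewrite e tcoef_sum big_seq big1 // => v vS; rewrite tcoefZ tcoef_TW /delta.
by case: eqP wS => [->|_]; rewrite ?vS ?mulr0.
Qed.

End HeckeBasis.

(** * The bar involution on double cosets *)

Section IntegralScalars.
Local Notation A := laurent.
Implicit Types (a b : A).

Lemma laurent_int_closed : GRing.subring_closed (mem laurent_int).
Proof.
split.
- by rewrite inE => S [[S1 _ _] _]; move: S1; rewrite inE.
- move=> a b; rewrite !inE => ha hb S [SS gS]; have [_ SB _] := SS.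
  by have := SB a b; rewrite !inE; apply; [apply: ha|apply: hb].
- move=> a b; rewrite !inE => ha hb S [SS gS]; have [_ _ SM] := SS.
  by have := SM a b; rewrite !inE; apply; [apply: ha|apply: hb].
Qed.

Lemma laurent_int1 : laurent_int 1.
Proof. by have [h _ _] := laurent_int_closed; move: h; rewrite inE. Qed.

Lemma laurent_intB a b : laurent_int a -> laurent_int b -> laurent_int (a - b).
Proof. by have [_ h _] := laurent_int_closed; have := h a b; rewrite !inE; apply. Qed.

Lemma laurent_intM a b : laurent_int a -> laurent_int b -> laurent_int (a * b).
Proof. by have [_ _ h] := laurent_int_closed; have := h a b; rewrite !inE; apply. Qed.

Lemma laurent_int0 : laurent_int 0.
Proof. by rewrite -(subrr 1); apply: laurent_intB; apply: laurent_int1. Qed.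

Lemma laurent_intD a b : laurent_int a -> laurent_int b -> laurent_int (a + b).
Proof.
move=> ha hb; rewrite -[b]opprK; apply: laurent_intB => //.
by rewrite -sub0r; apply: laurent_intB => //; apply: laurent_int0.
Qed.

Lemma laurent_int_q : [/\ laurent_int q /\ laurent_int q^-1,
  laurent_int q0 /\ laurent_int q0^-1 & laurent_int q1 /\ laurent_int q1^-1].
Proof.
have mem6 (T : eqType) (a1 a2 a3 a4 a5 a6 : T) (s := [:: a1; a2; a3; a4; a5; a6]) :
    [/\ a1 \in s /\ a2 \in s, a3 \in s /\ a4 \in s & a5 \in s /\ a6 \in s].
  by rewrite /s !inE !eqxx !orbT.
have [[h1 h2] [h3 h4] [h5 h6]] := mem6 _ q q^-1 q0 q0^-1 q1 q1^-1.
have gen a : a \in [:: q; q^-1; q0; q0^-1; q1; q1^-1] -> laurent_int a.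
  by move=> ha S [_]; apply.
split; split; apply: gen; [exact: h1|exact: h2|exact: h3|exact: h4|exact: h5|exact: h6].
Qed.

Lemma laurent_int_sum (T : Type) (r : seq T) (F : T -> A) :
  (forall k, laurent_int (F k)) -> laurent_int (\sum_(k <- r) F k).
Proof.
move=> h; elim: r => [|k r IH]; first by rewrite big_nil; apply: laurent_int0.
by rewrite big_cons; apply: laurent_intD.
Qed.

Lemma laurent_int_prod (T : Type) (r : seq T) (F : T -> A) :
  (forall k, laurent_int (F k)) -> laurent_int (\prod_(k <- r) F k).
Proof.
move=> h; elim: r => [|k r IH]; first by rewrite big_nil; apply: laurent_int1.
by rewrite big_cons; apply: laurent_intM.
Qed.

Lemma laurent_int_qs d (i : 'I_d.+1) : laurent_int (qs i) /\ laurent_int (qs i)^-1.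
Proof.
have [hq [h0 h0'] h1] := laurent_int_q.
rewrite /qs; case: ifP => _; first exact: h1.
case: ifP => _; last exact: hq.
by rewrite invrK; split; [exact: h0'|exact: h0].
Qed.

Lemma laurent_int_qpar d (i : 'I_d.+1) : laurent_int (qpar i) /\ laurent_int (qpar i)^-1.
Proof.
have [[hq hq'] [h0 h0'] [h1 h1']] := laurent_int_q.
rewrite /qpar; case: ifP => _; last case: ifP => _; rewrite invrK; split;
  [exact: h0'|exact: h0|exact: h1'|exact: h1|exact: hq'|exact: hq].
Qed.

End IntegralScalars.

Section Bar.
Variable d : nat.
Hypothesis hd : (1 < d)%N.
Local Notation W := (affC d).
Local Notation A := laurent.
Local Notation I := 'I_d.+1.
Local Notation word := (seq I).
Implicit Types (g w v : W) (i j s t : I) (u : word) (a b : A) (J K : set I) (x y z : hecke d).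

Lemma qqV i : (qq i)^-1 = (qs i)^-1 * (qpar i)^-1.
Proof. by rewrite /qq invrM ?qs_unit ?qpar_unit. Qed.

Lemma laurent_int_qqV i : laurent_int (qq i)^-1.
Proof.
rewrite qqV; apply: laurent_intM; first exact: (laurent_int_qs i).2.
exact: (laurent_int_qpar i).2.
Qed.

Lemma tcoef_rTinv s x w : tcoef (x * hTinv s) w =
  if rdesc w s then (qq s)^-1 * tcoef x (w * sgen s)%g
  else tcoef x (w * sgen s)%g - (qq s)^-1 * ((qpar s - qs s) * tcoef x w).
Proof.
rewrite /hTinv -scalerAr tcoefZ // mulrBr tcoefB // (tcoef_rT hd) mulr_algr tcoefZ //.
rewrite -/(qq s) /rop; case: (rdesc w s); first by rewrite addrK.
by rewrite mulrBr mulKr ?qq_unit.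
Qed.

(** The bar involution is triangular, with integral coefficients, on the T_w. *)
Lemma tcoef_bar_word u : reduced u ->
  [/\ forall w, laurent_int (tcoef (hbar (hTword u)) w),
      forall w, tcoef (hbar (hTword u)) w != 0 -> bruhat_le w (word_val u)
    & tcoef (hbar (hTword u)) (word_val u) = \prod_(k <- u) (qq k)^-1].
Proof.
elim/last_ind: u => [|u s IH].
  rewrite /hTword big_nil rmorph1 (tcoef1 hd) word_val_nil /delta => _; split=> [w|w|].
  - by case: (w =P 1%g) => _; [apply: laurent_int1|apply: laurent_int0].
  - by case: (w =P 1%g) => [-> _|]; [apply: bruhat_refl|rewrite eqxx].
  - by rewrite eqxx big_nil.
move=> /(reduced_rcons hd)[/IH[hint hsup hlead] hs].
have -> : hbar (hTword (rcons u s)) = hbar (hTword u) * hTinv s.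
  by rewrite /hTword -cats1 big_cat big_seq1 rmorphM /= hbarT.
rewrite word_val_rcons; move: hint hsup hlead; set phi := tcoef (hbar _) => hint hsup hlead.
have up w : bruhat_le w (word_val u) -> bruhat_le (w * sgen s)%g (word_val u * sgen s)%g.
  by move=> /(bruhat_mulS_up hd s); rewrite (negPf hs).
split=> [w|w|].
- rewrite tcoef_rTinv -/phi; case: ifP => _.
    by apply: laurent_intM; [apply: laurent_int_qqV|].
  apply: laurent_intB => //; apply: laurent_intM; first exact: laurent_int_qqV.
  by apply: laurent_intM => //; apply: laurent_intB;
    [exact: (laurent_int_qpar s).1|exact: (laurent_int_qs s).1].
- rewrite tcoef_rTinv -/phi; have [e|/hsup/up] := eqVneq (phi (w * sgen s)%g) 0;
    last by rewrite mulsK.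
  rewrite e mulr0; case: ifP => _; first by rewrite eqxx.
  have [->|/hsup h _] := eqVneq (phi w) 0; first by rewrite !mulr0 subrr eqxx.
  exact: bruhat_trans h (bruhat_asc hd hs).
- rewrite tcoef_rTinv (rdescS hd) hs mulsK // -/phi hlead.
  by rewrite -cats1 big_cat big_seq1 mulrC.
Qed.

Lemma tcoef_bar_TW v :
  [/\ forall w, laurent_int (tcoef (hbar (hTW v)) w),
      forall w, tcoef (hbar (hTW v)) w != 0 -> bruhat_le w v
    & tcoef (hbar (hTW v)) v = \prod_(k <- rexpr v) (qq k)^-1].
Proof.
by have := tcoef_bar_word (@reduced_rexpr _ hd v); rewrite (word_rexpr hd).
Qed.

Lemma qW_unit w : qW w \is a GRing.unit.
Proof. by apply: prod_unit; apply: qs_unit. Qed.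

Lemma lbar_qWV w : lbar (qW w)^-1 = qW w.
Proof.
rewrite rmorphV ?qW_unit //= /qW rmorph_prod /= -prodrV;
  last by move=> i _; rewrite lbar_qs unitrV qs_unit.
by apply: eq_bigr => i _; rewrite lbar_qs invrK.
Qed.

Lemma laurent_int_qW w : laurent_int (qW w) /\ laurent_int (qW w)^-1.
Proof.
split; first by apply: laurent_int_prod => i; apply: (laurent_int_qs i).1.
rewrite /qW -prodrV => [|i _]; last exact: qs_unit.
by apply: laurent_int_prod => i; apply: (laurent_int_qs i).2.
Qed.

Lemma qW_word u : reduced u -> \prod_(k <- u) qs k = qW (word_val u).
Proof.
move=> ru; apply: (matsumoto hd (qs_braid hd)) => //; first exact: reduced_rexpr.
by rewrite (word_rexpr hd).
Qed.

Lemma qW_lasc w s : ~~ ldesc w s -> qW (sgen s * w)%g = qs s * qW w.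
Proof.
move=> h; have r : reduced (s :: rexpr w).
  by apply/(reduced_cons hd); rewrite (word_rexpr hd); split=> //; apply: reduced_rexpr.
by have := qW_word r; rewrite word_val_cons (word_rexpr hd) big_cons => ->.
Qed.

Lemma qW_rasc w s : ~~ rdesc w s -> qW (w * sgen s)%g = qs s * qW w.
Proof.
move=> h; have r : reduced (rcons (rexpr w) s).
  by apply/(reduced_rcons hd); rewrite (word_rexpr hd); split=> //; apply: reduced_rexpr.
have := qW_word r; rewrite word_val_rcons (word_rexpr hd) => <-.
by rewrite -cats1 big_cat big_seq1 mulrC.
Qed.

(** The elements on which the parabolic generators act by their first
    eigenvalue, on the left for [J] and on the right for [K] *)
Definition eigen J K x : Prop :=
  (forall s, J s -> hT s * x = qpar s *: x) /\
  (forall s, K s -> x * hT s = qpar s *: x).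

(** [eigen_desc] and [eigen_asc] are the two cases, according to descents, of the
    eigenvalue equation at one coefficient. *)
Lemma eigen_desc (p s P x y : A) : s \is a GRing.unit -> P \is a GRing.unit ->
  y + (p - s) * x = p * x <-> P * y = s * P * x.
Proof.
move=> su Pu; split=> h.
  have -> : y = s * x by apply: (addIr ((p - s) * x)); rewrite h; ring.
  by ring.
have -> : y = s * x by apply: (mulrI Pu); rewrite h; ring.
by ring.
Qed.

Lemma eigen_asc (p s P x y : A) : p \is a GRing.unit -> P \is a GRing.unit ->
  p * s * y = p * x <-> s * P * y = P * x.
Proof.
move=> pu Pu; split=> h.
  have <- : s * y = x by apply: (mulrI pu); rewrite -h mulrA.
  by ring.
have <- : s * y = x by apply: (mulrI Pu); rewrite -h; ring.
by ring.
Qed.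

Lemma eigen_lP s x : hT s * x = qpar s *: x <->
  forall w, qW (sgen s * w)%g * tcoef x (sgen s * w)%g = qW w * tcoef x w.
Proof.
have pt w : lop s (tcoef x) w = qpar s * tcoef x w <->
    qW (sgen s * w)%g * tcoef x (sgen s * w)%g = qW w * tcoef x w.
  rewrite /lop; case: (boolP (ldesc w s)) => h.
    have h' : ~~ ldesc (sgen s * w)%g s by rewrite ldescS // h.
    have := qW_lasc h'; rewrite mulKs // => ->.
    by apply: eigen_desc; [apply: qs_unit|apply: qW_unit].
  by rewrite qW_lasc //; apply: eigen_asc; [apply: qpar_unit|apply: qW_unit].
split=> [h w|h]; first by apply/pt; rewrite -tcoef_lT // h tcoefZ.
by apply: (tcoef_inj hd) => w; rewrite (tcoef_lT hd) (tcoefZ hd); apply/pt.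
Qed.

Lemma eigen_rP s x : x * hT s = qpar s *: x <->
  forall w, qW (w * sgen s)%g * tcoef x (w * sgen s)%g = qW w * tcoef x w.
Proof.
have pt w : rop s (tcoef x) w = qpar s * tcoef x w <->
    qW (w * sgen s)%g * tcoef x (w * sgen s)%g = qW w * tcoef x w.
  rewrite /rop; case: (boolP (rdesc w s)) => h.
    have h' : ~~ rdesc (w * sgen s)%g s by rewrite rdescS // h.
    have := qW_rasc h'; rewrite mulsK // => ->.
    by apply: eigen_desc; [apply: qs_unit|apply: qW_unit].
  by rewrite qW_rasc //; apply: eigen_asc; [apply: qpar_unit|apply: qW_unit].
split=> [h w|h]; first by apply/pt; rewrite -tcoef_rT // h tcoefZ.
by apply: (tcoef_inj hd) => w; rewrite (tcoef_rT hd) (tcoefZ hd); apply/pt.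
Qed.

(** The normalized coefficients of an eigenvector are constant on double cosets. *)
Lemma eigen_dc J K x v w : eigen J K x -> dc J K v w ->
  qW w * tcoef x w = qW v * tcoef x v.
Proof.
move=> [hl hr]; move: w; apply: (dc_ind hd) => // w s Hs <-.
  by have [h _] := eigen_lP s x; apply: h; apply: hl.
by have [h _] := eigen_rP s x; apply: h; apply: hr.
Qed.

Lemma eigenB J K a x y : eigen J K x -> eigen J K y -> eigen J K (x - a *: y).
Proof.
move=> [xl xr] [yl yr]; split=> s Hs.
  by rewrite mulrBr -scalerAr xl // yl // scalerBr !scalerA mulrC.
by rewrite mulrBl -scalerAl xr // yr // scalerBr !scalerA mulrC.
Qed.

Lemma eigen_bar J K x : eigen J K x -> eigen J K (hbar x).
Proof.
have bq s : lbar (qpar s) = (qpar s)^-1 by apply: lbar_qpar.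
move=> [xl xr]; split=> s Hs.
  have := congr1 (@hbar d) (xl s Hs); rewrite rmorphM /= hbarT hbarZ bq => h.
  have := congr1 (fun y => qpar s *: (hT s * y)) h.
  by rewrite mulrA hTTinv mul1r -scalerAr scalerA mulrV ?qpar_unit // scale1r.
have := congr1 (@hbar d) (xr s Hs); rewrite rmorphM /= hbarT hbarZ bq => h.
have := congr1 (fun y => qpar s *: (y * hT s)) h.
by rewrite -mulrA hTinvT mulr1 -scalerAl scalerA mulrV ?qpar_unit // scale1r.
Qed.

(** An infinite sum is 0 by convention, as no [T_w] vanishes. *)
Lemma hTset_infinite (X : set W) : infinite_set X -> hTset X = 0.
Proof.
move=> h; apply: fsbig_dflt; apply: contra_not h.
apply: sub_finite_set => w Xw; split=> //= e.
have := congr1 (fun y => tcoef y w) e; rewrite (tcoefZ hd) (tcoef_TW hd) (tcoef0 hd).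
rewrite /delta eqxx mulr1 => /eqP; rewrite invr_eq0 => /eqP q0.
by have := qW_unit w; rewrite q0 unitr0.
Qed.

Lemma hTset_finite (X : set W) : finite_set X ->
  hTset X = \sum_(w <- fset_set X) (qW w)^-1 *: hTW w.
Proof. exact: fsbig_finite. Qed.

Lemma tcoef_hTset (X : set W) w : finite_set X ->
  tcoef (hTset X) w = if `[< X w >] then (qW w)^-1 else 0.
Proof.
move=> fX; rewrite hTset_finite // tcoef_sum //.
under eq_bigr => v _ do rewrite (tcoefZ hd) (tcoef_TW hd) /delta.
case: asboolP => Xw.
  rewrite (bigD1_seq w) ?fset_uniq ?in_fset_set ?inE //= eqxx mulr1 big1 ?addr0 //.
  by move=> v; rewrite eq_sym => /negPf ->; rewrite mulr0.
rewrite big_seq big1 // => v; rewrite in_fset_set // inE => Xv.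
by case: eqP => [e|_]; [case: Xw; rewrite e|rewrite mulr0].
Qed.

Lemma eigen_hTset J K g : finite_set (dc J K g) -> eigen J K (hTset (dc J K g)).
Proof.
move=> fX; have cst w w' : dc J K w w' ->
    qW w' * tcoef (hTset (dc J K g)) w' = qW w * tcoef (hTset (dc J K g)) w.
  move=> ww'; rewrite !tcoef_hTset //; case: asboolP => h.
    have -> : `[< dc J K g w >].
      by apply/asboolP; apply: (dc_trans h); apply: dc_sym.
    by rewrite !mulrV ?qW_unit.
  case: asboolP => h'; last by rewrite !mulr0.
  by case: h; apply: dc_trans h' ww'.
split=> s Hs.
  by apply/eigen_lP => w; apply: cst; apply: dc_l.
by apply/eigen_rP => w; apply: cst; apply: dc_r.
Qed.

(** If one double coset is finite, so are both parabolic subgroups. *)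
Lemma finite_dc J K g (y : W) : finite_set (dc J K g) -> finite_set (dc J K y).
Proof.
move=> fX.
have fJ : finite_set (Wpar J).
  apply: (@sub_finite_set _ _ [set w * g^-1 | w in dc J K g]%g%classic);
    last exact: finite_image.
  move=> a Ja; exists (a * g)%g; last by rewrite mulgK.
  by exists a => //; exists 1%g; [apply: Wpar1|rewrite mulg1].
have fK : finite_set (Wpar K).
  apply: (@sub_finite_set _ _ [set g^-1 * w | w in dc J K g]%g%classic);
    last exact: finite_image.
  move=> b Kb; exists (g * b)%g; last by rewrite mulgA mulVg mul1g.
  by exists 1%g; [apply: Wpar1|exists b => //; rewrite mul1g].
exact: finite_image2.
Qed.

Lemma int_spanP (X : set (hecke d)) : int_span X 0 /\
  (forall a x y, laurent_int a -> int_span X x -> int_span X y -> int_span X (a *: x + y)).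
Proof.
split; first by move=> M [[M0 _] _].
move=> a x y ha hx hy M [MM XM]; case: (MM) => _; apply=> //; [exact: hx|exact: hy].
Qed.

Lemma int_span_gen (X : set (hecke d)) x : X x -> int_span X x.
Proof. by move=> Xx M [_]; apply. Qed.

Lemma int_span_min (X M : set (hecke d)) : M 0 ->
  (forall a x y, laurent_int a -> M x -> M y -> M (a *: x + y)) ->
  (forall x, X x -> M x) -> forall x, int_span X x -> M x.
Proof. by move=> M0 MM XM x; apply. Qed.

Lemma int_span_sub (X Y : set (hecke d)) x : (forall y, X y -> Y y) ->
  int_span X x -> int_span Y x.
Proof.
move=> XY; have [h0 h1] := int_spanP Y; apply: int_span_min => // y /XY.
exact: int_span_gen.
Qed.

(** An eigenvector with integral coefficients is an integral combination of the
    T_X, for X ranging over the double cosets of the distinguished [y] at which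
    its coefficient is not zero. *)
Lemma eigen_span J K x
  (supp := fun x => [set y : W | dmin J K y /\ tcoef x y <> 0]%classic) :
  (forall y : W, finite_set (dc J K y)) -> eigen J K x ->
  (forall w, laurent_int (tcoef x w)) ->
  int_span [set hTset (dc J K y) | y in supp x]%classic x.
Proof.
move=> fX; have [S0 hS0] := tcoef_support hd x.
have {hS0} : forall w, tcoef x w != 0 -> w \in undup S0.
  by move=> w; rewrite mem_undup; apply: hS0.
have := undup_uniq S0; move: (undup S0) => S; have [n] := ubnP (size S).
elim: n S x => // n IH S x hn uS hS ex ix.
have [[w hw]|no] := pselect (exists w, tcoef x w != 0); last first.
  suff -> : x = 0 by case: (int_spanP [set hTset (dc J K y) | y in supp 0]%classic).
  apply: (tcoef_inj hd) => w; rewrite (tcoef0 hd); apply/eqP; apply: contra_notT no => h.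
  by exists w.
have [y [my wy]] := dmin_exists hd J K w.
have nz v v' : dc J K v v' -> tcoef x v != 0 -> tcoef x v' != 0.
  move=> vv'; apply: contraNneq => e; have := eigen_dc ex vv'; rewrite e mulr0.
  by move=> h; apply/eqP; apply: (mulrI (qW_unit v)); rewrite mulr0.
have ny := nz _ _ wy hw.
(* subtracting a multiple of T_X, for X the double coset of [y], empties X *)
pose c := qW y * tcoef x y; pose x' := x - c *: hTset (dc J K y).
have ic : laurent_int c by apply: laurent_intM => //; apply: (laurent_int_qW y).1.
have cx' v : tcoef x' v = if `[< dc J K y v >] then 0 else tcoef x v.
  rewrite (tcoefB hd) (tcoefZ hd) tcoef_hTset //; case: asboolP => h;
    last by rewrite mulr0 subr0.
  by rewrite /c -(eigen_dc ex h) mulrAC mulrV ?qW_unit // mul1r subrr.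
have ex' : eigen J K x' by apply: eigenB => //; apply: eigen_hTset.
have yS : y \in S by apply: hS.
have hx' : int_span [set hTset (dc J K v) | v in supp x']%classic x'.
  apply: (IH (rem y S)) => //.
  - by rewrite size_rem //; case: (S) yS hn => //=; lia.
  - exact: rem_uniq.
  - move=> v; rewrite cx' mem_rem_uniq //; case: asboolP => [|h hv]; first by rewrite eqxx.
    by rewrite !inE hS // andbT; apply: contra_notN h => /eqP ->; apply: dc_refl.
  - by move=> v; rewrite cx'; case: ifP => _ //; apply: laurent_int0.
have e : x = c *: hTset (dc J K y) + x' by rewrite addrC subrK.
have [_ lin] := int_spanP [set hTset (dc J K v) | v in supp x]%classic.
rewrite {2}e; apply: lin => //.
  by apply: int_span_gen; exists y => //; split=> //; apply/eqP.
apply: int_span_sub hx' => _ [v [mv hv] <-]; exists v => //; split=> //.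
by move: hv; rewrite cx'; case: ifP.
Qed.

Lemma longest_exists (X : set W) g : finite_set X -> X g -> is_longest X (longest X).
Proof.
move=> fX Xg; rewrite /longest; case: xgetP => [_ -> //|no]; exfalso.
suff [v hv] : exists v, is_longest X v by apply: (no v).
(* a bound on the lengths, to search upwards from [g] *)
pose N := (\sum_(w <- fset_set X) len w)%N.
have hN w : X w -> (len w <= N)%N.
  move=> Xw; rewrite /N (bigD1_seq w) ?fset_uniq ?in_fset_set ?inE //=; lia.
have [n] := ubnP (N - len g)%N; elim: n g Xg => // n IH g Xg hn.
have [[v [Xv hv]]|nov] := pselect (exists v, X v /\ (len g < len v)%N).
  by apply: (IH v) => //; have := hN v Xv; lia.
exists g; split=> // v Xv; rewrite leqNgt; apply/negP => h; apply: nov.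
by exists v.
Qed.

(** The product of the qs s / qpar s along a reduced expression of [v]; for [v]
    longest in X, the diagonal coefficient of the bar involution at T_X *)
Definition bar_scalar v : A := \prod_(k <- rexpr v) (qs k * (qpar k)^-1).

Lemma laurent_int_bar_scalar v : laurent_int (bar_scalar v).
Proof.
apply: laurent_int_prod => k; apply: laurent_intM; first exact: (laurent_int_qs k).1.
exact: (laurent_int_qpar k).2.
Qed.

Lemma bar_scalarE v : bar_scalar v = qW v * (\prod_(k <- rexpr v) (qq k)^-1) * qW v.
Proof.
rewrite /bar_scalar /qW -!big_split /=; apply: eq_bigr => k _.
by rewrite qqV mulrA mulrV ?qs_unit // mul1r mulrC.
Qed.

(** Triangularity of the bar involution on double cosets *)
Theorem bar_double_coset J K g : finite_set (dc J K g) -> dmin J K g ->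
  exists2 z, int_span [set hTset (dc J K y) | y in
                 [set y | dmin J K y /\ bruhat_lt y g]]%classic z &
    hbar (hTset (dc J K g)) =
      bar_scalar (longest (dc J K g)) *: hTset (dc J K g) + z.
Proof.
move=> fX mg; set X := dc J K g; set h := hTset X; set gp := longest X.
have [Xgp maxgp] : is_longest X gp by apply: (@longest_exists _ g) => //; apply: dc_refl.
have eh : eigen J K h by apply: eigen_hTset.
have fS v : (v \in fset_set X) = `[< X v >] by rewrite in_fset_set.
have cbh w : tcoef (hbar h) w = \sum_(v <- fset_set X) qW v * tcoef (hbar (hTW v)) w.
  rewrite /h hTset_finite // rmorph_sum /= tcoef_sum //; apply: eq_bigr => v _.
  by rewrite hbarZ lbar_qWV tcoefZ.
have ibh w : laurent_int (tcoef (hbar h) w).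
  rewrite cbh; apply: laurent_int_sum => v; have [hi _ _] := tcoef_bar_TW v.
  by apply: laurent_intM => //; apply: (laurent_int_qW v).1.
have sbh w : tcoef (hbar h) w <> 0 -> exists2 v, X v & bruhat_le w v.
  move=> hw; apply: contrapT => no; apply: hw; rewrite cbh big_seq big1 // => v.
  rewrite fS => /asboolP Xv; apply/eqP; apply: contra_notT no => nz; exists v => //.
  have [_ hs _] := tcoef_bar_TW v; apply: hs.
  by apply: contraNneq nz => ->; rewrite mulr0.
set c := bar_scalar gp; exists (hbar h - c *: h); last by rewrite addrC subrK.
have ez : eigen J K (hbar h - c *: h) by apply: eigenB => //; apply: eigen_bar.
have ch w : tcoef h w = if `[< X w >] then (qW w)^-1 else 0 by apply: tcoef_hTset.
(* the bar image of [T_v] involves [T_gp] only if gp <= v, hence only for v = gp *)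
have lead : tcoef (hbar h) gp = qW gp * \prod_(k <- rexpr gp) (qq k)^-1.
  rewrite cbh (bigD1_seq gp) ?fset_uniq ?fS //=; last exact/asboolP.
  have [_ _ ->] := tcoef_bar_TW gp.
  rewrite [X in _ + X]big_seq_cond [X in _ + X]big1 ?addr0 // => v /andP[].
  rewrite fS => /asboolP Xv nv.
  have [_ hs _] := tcoef_bar_TW v; apply/eqP; apply: contraNT nv => nz.
  have /hs/bruhat_eq : tcoef (hbar (hTW v)) gp != 0.
    by apply: contraNneq nz => ->; rewrite mulr0.
  by move=> -> //; apply: maxgp.
(* by invariance, vanishing at the longest element [gp] is vanishing at [g] *)
have zg : tcoef (hbar h - c *: h) g = 0.
  have /(eigen_dc ez) : dc J K g gp by [].
  rewrite (tcoefB hd) (tcoefZ hd) lead ch asboolT // /c bar_scalarE.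
  rewrite mulrK ?qW_unit // subrr mulr0.
  by move=> e; apply: (mulrI (qW_unit g)); rewrite mulr0.
apply: int_span_sub (eigen_span _ ez _); last first.
- move=> w; rewrite (tcoefB hd) (tcoefZ hd) ch; apply: laurent_intB => //.
  apply: laurent_intM; first exact: laurent_int_bar_scalar.
  by case: ifP => _; [apply: (laurent_int_qW w).2|apply: laurent_int0].
- by move=> y; apply: finite_dc fX.
move=> _ [y [my hy] <-]; exists y => //; split=> //.
have below : exists2 v, X v & bruhat_le y v.
  have [e|/eqP/sbh//] := eqVneq (tcoef (hbar h) y) 0.
  move: hy; rewrite (tcoefB hd) (tcoefZ hd) e ch; case: asboolP => [Xy _|_].
    by exists y => //; apply: bruhat_refl.
  by rewrite mulr0 subrr.
split; last by move=> e; apply: hy; rewrite e.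
by have [v Xv yv] := below; apply: (dmin_bruhat hd my yv); apply: dc_sym.
Qed.

Lemma bar_scalar_expr v : bar_scalar v =
  q0 ^ ((len_c0 v)%:Z - (len_cd v)%:Z) * q1 ^+ (len_c0 v + len_cd v) * q ^+ (2 * len_a v).
Proof.
have [uq uq0 uq1] := q_unit.
rewrite /bar_scalar /len_a /len_c0 /len_cd /len.
have le (u : word) : (count_mem ord0 u + count_mem ord_max u <= size u)%N.
  elim: u => //= k u IH; have : ((k == ord0) + (k == ord_max) <= 1)%N; last by lia.
  by case: eqP => [->|_]; case: eqP => // /(congr1 val) /=; lia.
elim: (rexpr v) => [|k u IH]; first by rewrite big_nil /= subrr !expr0 expr0z !mulr1.
rewrite big_cons IH /= /qs /qpar; have := le u.
move: (count_mem ord0 u) (count_mem ord_max u) (size u) => a b n abn.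
case: (k =P 0 :> nat) => k0; last case: (k =P d :> nat) => kd.
- have -> : k = ord0 by apply: val_inj.
  rewrite eqxx; have -> : (ord0 == ord_max :> I) = false by apply/eqP => /(congr1 val) /=; lia.
  rewrite !add0n !add1n invrK addSn.
  have -> : (n.+1 - a.+1 - b = n - a - b)%N by lia.
  have -> : a.+1%:Z - b%:Z = 1%:Z + (a%:Z - b%:Z) by lia.
  have e1 : q0 ^ 1%:Z = q0 := expr1z q0.
  by rewrite (exprzDr uq0 1%:Z) e1 exprS; ring.
- have -> : k = ord_max by apply: val_inj.
  rewrite eqxx; have -> : (ord_max == ord0 :> I) = false by apply/eqP => /(congr1 val) /=; lia.
  rewrite !add0n !add1n invrK addnS.
  have -> : (n.+1 - a - b.+1 = n - a - b)%N by lia.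
  have -> : a%:Z - b.+1%:Z = - 1%:Z + (a%:Z - b%:Z) by lia.
  have e1 : q0 ^ (- 1%:Z) = q0^-1 := exprN1 q0.
  by rewrite (exprzDr uq0 (- 1%:Z)) e1 exprS; ring.
- have -> : (k == ord0) = false by apply/eqP => e; apply: k0; rewrite e.
  have -> : (k == ord_max) = false by apply/eqP => e; apply: kd; rewrite e.
  rewrite !add0n invrK.
  have -> : (2 * (n.+1 - a - b) = (2 * (n - a - b)).+2)%N by lia.
  by rewrite !exprS; ring.
Qed.

End Bar.

Local Open Scope classical_set_scope.
Local Open Scope ring_scope.

Theorem proposition4p1 (r d : nat) (hd : (2 <= d)%N)
    (lam mu : {ffun 'I_r.+2 -> nat})
    (hlam : Lambda d lam) (hmu : Lambda d mu)
    (g : affC d) (hg : Ddouble lam mu g) :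
  let gp := longest (dcoset lam g mu) in
  let w0 := longest (parabolic mu : set (affC d)) in
  [/\ Hd lam mu (hbar (hTd lam mu g)),
      exists2 z : hecke d,
        int_span [set hTd lam mu y | y in
                    [set y | Ddouble lam mu y /\ bruhat_lt y g]] z &
        hbar (hTd lam mu g) =
          (q0 ^ ((len_c0 gp)%:Z - (len_cd gp)%:Z)
           * q1 ^+ (len_c0 gp + len_cd gp)
           * q ^+ (2 * len_a gp)) *: hTd lam mu g + z
    & let x := (q0h ^ ((len_c0 w0)%:Z - (len_cd w0)%:Z)
                * q1h ^+ (len_c0 w0 + len_cd w0)
                * q ^+ len_a w0) *: hTset (parabolic mu : set (affC d)) in
      hbar x = x].
Proof.
move=> gp w0.
pose J := [set k : 'I_d.+1 | forall i, k <> psum lam i :> nat].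
pose K := [set k : 'I_d.+1 | forall i, k <> psum mu i :> nat].
have mg : dmin J K g by exact: hg.
have [_ lin] := int_spanP [set hTd lam mu y | y in (Ddouble lam mu : set (affC d))].
have [z0 _] := int_spanP [set hTd lam mu (y : affC d) | y in
                    [set y | Ddouble lam mu y /\ bruhat_lt y g]].
have [z hz ez] : exists2 z : hecke d,
    int_span [set hTd lam mu y | y in
                    [set y | Ddouble lam mu y /\ bruhat_lt y g]] z &
    hbar (hTd lam mu g) = bar_scalar gp *: hTd lam mu g + z.
  have [fX|iX] := pselect (finite_set (dc J K g)).
    exact: (bar_double_coset hd fX mg).
  have e0 : hTd lam mu g = 0 by exact: (hTset_infinite hd iX).
  by exists 0 => //; rewrite e0 scaler0 rmorph0 addr0.
split.
- rewrite ez; apply: lin; first exact: laurent_int_bar_scalar.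
    by apply: int_span_gen; exists g.
  apply: int_span_sub hz => _ [y [my _] <-]; by exists y.
- by exists z => //; rewrite ez (bar_scalar_expr hd).
move=> x; have [fX|iX] := pselect (finite_set (parabolic mu : set (affC d))); last first.
  have e0 : hTset (parabolic mu : set (affC d)) = 0 by exact: (hTset_infinite hd iX).
  by rewrite /x e0 scaler0 rmorph0.
(* the parabolic subgroup is the double coset of 1 *)
have eX : dc K K 1%g = parabolic mu :> set (affC d).
  apply/seteqP; split=> [_ [a Ka [b Kb <-]]|a Ka].
    by rewrite mulg1; apply: (WparM Ka Kb).
  by exists a => //; exists 1%g; [apply: Wpar1|rewrite !mulg1].
have m1 : dmin K K (1%g : affC d).
  by split=> a _; rewrite ?invg1 mulg1 (len1 hd) addn0.
have fX' : finite_set (dc K K (1%g : affC d)) by rewrite eX.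
have [z' hz' ez'] := bar_double_coset hd fX' m1.
have {}hz' : z' = 0.
  move: z' hz' {ez'}; apply: int_span_min => // [a u v _ -> ->|v [y [_ [y1 ny]] _]].
    by rewrite scaler0 addr0.
  by case: ny; apply: (bruhat_eq hd y1); rewrite (len1 hd).
rewrite eX -/w0 hz' addr0 (bar_scalar_expr hd) in ez'.
rewrite /x hbarZ ez' scalerA; congr (_ *: _).
move: (len_c0 w0) (len_cd w0) (len_a w0) => a b n.
have u0 : q0h \is a GRing.unit by apply: lmon_unit.
have u1 : q1h \is a GRing.unit by apply: lmon_unit.
have [uq _ _] := q_unit; have [bq _ _] := lbar_q.
have b0 : lbar q0h = q0h^-1 by apply: lbar_mon.
have b1 : lbar q1h = q1h^-1 by apply: lbar_mon.
set e := a%:Z - b%:Z.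
have -> : q0 ^ e = q0h ^ e * q0h ^ e.
  by rewrite -(exprzDr u0) /q0 exprnP exprz_exp; congr (_ ^ _); lia.
have u0e : q0h ^ e \is a GRing.unit by apply: unitrXz.
have u1m : q1h ^+ (a + b) \is a GRing.unit by rewrite unitrX.
have uqn : q ^+ n \is a GRing.unit by rewrite unitrX.
have -> : lbar (q0h ^ e * q1h ^+ (a + b) * q ^+ n) =
    (q0h ^ e)^-1 * (q1h ^+ (a + b))^-1 * (q ^+ n)^-1.
  have -> : (q0h ^ e)^-1 = lbar (q0h ^ e) by rewrite rmorphXz //= b0 exprz_inv invr_expz.
  have -> : (q1h ^+ (a + b))^-1 = lbar (q1h ^+ (a + b)) by rewrite rmorphXn /= b1 exprVn.
  have -> : (q ^+ n)^-1 = lbar (q ^+ n) by rewrite rmorphXn /= bq exprVn.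
  by rewrite -!rmorphM.
have -> : q1 ^+ (a + b) = q1h ^+ (a + b) * q1h ^+ (a + b).
  by rewrite -exprMn -expr2.
have -> : q ^+ (2 * n) = q ^+ n * q ^+ n by rewrite mulnC exprM expr2.
move: (q0h ^ e) (q1h ^+ _) (q ^+ n) u0e u1m uqn => x0 x1 x2 v0 v1 v2.
have -> : x0^-1 * x1^-1 * x2^-1 * (x0 * x0 * (x1 * x1) * (x2 * x2)) =
  (x0^-1 * x0) * (x1^-1 * x1) * (x2^-1 * x2) * (x0 * x1 * x2) by ring.
by rewrite !mulVr // !mul1r.
Qed.
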